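(* Let $q=k^n$ for some $n\in\mathbb{N}$ and some prime number $k$, and let $G_q$ be an $\widetilde{A}_2$-group of order $q$. Then $$H^1(G_q,\pi)=0$$ for all $$2\le p<\dfrac{\ln(q^2+q+1)+\ln(q+1)}{\dfrac{1}{2}\ln\big(2(q^2+q+1)(q+1)\big)-\ln(2)-\ln\left(\sqrt{1-\dfrac{\sqrt{q}}{q+1}}\right)}$$ and for any isometric representation $\pi$ of $G_q$ on $L_p(Y,\mu)$, for any measure space $(Y,\mu)$.
   Context: $\widetilde{A}_2$-groups. For a group $G$ with a finite symmetric generating set $S=S^{-1}$ not containing the identity, the link graph $\mathcal{L}(S)$ has vertex set $S$, with $s,t\in S$ joined by an edge iff $s^{-1}t\in S$ (equivalently $t^{-1}s\in S$). The $\widetilde{A}_2$-group $G_q$ has a finite symmetric generating set $S$, not containing the identity, whose link graph $\mathcal{L}(S)$ is the incidence graph of the finite projective plane $\mathbf{P}^2(\mathbb{F}_q)$, i.e. the bipartite graph whose vertices are the $q^2+q+1$ points and the $q^2+q+1$ lines of $\mathbf{P}^2(\mathbb{F}_q)$, a point and a line being joined iff they are incident. For the purposes of this statement, ''an $\widetilde{A}_2$-group of order $q$'' means a group admitting such a generating set. Cohomology. An isometric representation $\pi$ of $G$ on a Banach space $X$ is a homomorphism from $G$ to the group of invertible linear isometries of $X$. A 1-cocycle for $\pi$ is a map $b:G\to X$ with $b_{gh}=\pi_g b_h+b_g$ for all $g,h\in G$; a coboundary is a cocycle of the form $b_g=v-\pi_g v$ for some $v\in X$. $H^1(G,\pi)$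 is the quotient of cocycles by coboundaries. *)

(* Defs.v *)
From HB Require Import structures.
From mathcomp Require Import all_boot all_order all_algebra.
From mathcomp Require Import all_classical all_reals all_analysis.
From mathcomp Require Import finmap complex measurable_realfun.
Set Implicit Arguments.
Unset Strict Implicit.
Unset Printing Implicit Defensive.
Import Order.TTheory GRing.Theory Num.Theory.
Import numFieldNormedType.Exports.
Local Open Scope quotient_scope.
Local Open Scope ring_scope.

Record seminorm (K : numFieldType) (V : lmodType K) := Seminorm {
  seminorm_fun :> V -> K;
  ler_seminormD : forall x y,
    seminorm_fun (x + y) <= seminorm_fun x + seminorm_fun y;
  seminormZ : forall a x, seminorm_fun (a *: x) = `|a| * seminorm_fun x
}.

Section SeminormKernel.
Context {K : numFieldType} {V : lmodType K} (N : seminorm V).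

Definition seminorm_ker : {pred V} := [pred x | N x == 0].

Lemma seminorm0 : N 0 = 0.
Proof. by rewrite -(scale0r (0 : V)) seminormZ normr0 mul0r. Qed.

Lemma seminormN x : N (- x) = N x.
Proof. by rewrite -scaleN1r seminormZ normrN1 mul1r. Qed.

Lemma seminorm_ge0 x : 0 <= N x.
Proof.
have := ler_seminormD N x (- x).
rewrite subrr seminorm0 seminormN -mulr2n -mulr_natl.
by rewrite pmulr_rge0 // ltr0n.
Qed.

Lemma seminorm_ker_submod : submod_closed seminorm_ker.
Proof.
split=> [|a x y]; rewrite !inE ?seminorm0 // => /eqP x0 /eqP y0.
rewrite eq_le seminorm_ge0 andbT (le_trans (ler_seminormD _ _ _)) //.
by rewrite seminormZ x0 y0 mulr0 addr0.
Qed.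

HB.instance Definition _ :=
  GRing.isSubmodClosed.Build K V seminorm_ker seminorm_ker_submod.

Lemma seminorm_sub_eq x y : x - y \in seminorm_ker -> N x = N y.
Proof.
rewrite inE => /eqP xy0.
have yx0 : N (y - x) = 0 by rewrite -opprB seminormN.
apply/eqP; rewrite eq_le; apply/andP; split.
  by have := ler_seminormD N (x - y) y; rewrite subrK xy0 add0r.
by have := ler_seminormD N (y - x) x; rewrite subrK yx0 add0r.
Qed.

(* The normed space associated with a seminormed one: V modulo N = 0. *)
Definition normed_quotient : Type := Quotient.quot seminorm_ker.

HB.instance Definition _ := GRing.Zmodule.on normed_quotient.
HB.instance Definition _ := EqQuotient.on normed_quotient.

Local Notation Q := normed_quotient.
Local Notation "[ x ]" := (\pi_Q x).

Lemma normed_quotient_eq (x y : V) :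
  ([x] == [y]) = (x - y \in seminorm_ker).
Proof. by rewrite eqmodE. Qed.

Let nq_scale (a : K) (u : Q) : Q := [a *: repr u].
Let nq_norm (u : Q) : K := N (repr u).

Let piD (x y : V) : [x + y] = [x] + [y].
Proof. exact: (@Quotient.pi_add V seminorm_ker x y). Qed.

Let pi0 : [0] = 0.
Proof. by apply: (addIr [0]); rewrite -piD !add0r. Qed.

Let nq_scaleE a x : nq_scale a [x] = [a *: x].
Proof.
apply/eqP; rewrite /nq_scale normed_quotient_eq -scalerBr rpredZ //.
by rewrite -normed_quotient_eq reprK.
Qed.

Let nq_normE x : nq_norm [x] = N x.
Proof. by apply: seminorm_sub_eq; rewrite -normed_quotient_eq reprK. Qed.

Let nq_scaleA a b u : nq_scale a (nq_scale b u) = nq_scale (a * b) u.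
Proof.
move: (nq_scale) nq_scaleE => sc scE.
by rewrite -[u]reprK !scE scalerA. Qed.

Let nq_scale1 : left_id 1 nq_scale.
Proof.
move: (nq_scale) nq_scaleE => sc scE.
by move=> u; rewrite -[u]reprK scE scale1r. Qed.

Let nq_scaleDr : right_distributive nq_scale +%R.
Proof.
move: (nq_scale) nq_scaleE => sc scE.
by move=> a u v; rewrite -[u]reprK -[v]reprK -piD !scE scalerDr piD.
Qed.

Let nq_scaleDl u : {morph nq_scale^~ u : a b / a + b}.
Proof.
move: (nq_scale) nq_scaleE => sc scE.
by move=> a b; rewrite -[u]reprK !scE scalerDl piD. Qed.

HB.instance Definition _ := GRing.Zmodule_isLmodule.Build K Q
  nq_scaleA nq_scale1 nq_scaleDr nq_scaleDl.

Let ler_nq_normD u v : nq_norm (u + v) <= nq_norm u + nq_norm v.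
Proof.
move: (nq_norm) nq_normE => nm nmE.
by rewrite -[u]reprK -[v]reprK -piD !nmE ler_seminormD.
Qed.

Let nq_normZ a u : nq_norm (a *: u) = `|a| * nq_norm u.
Proof.
move: (nq_norm) nq_normE => nm nmE.
by rewrite -[u]reprK [_ *: _]nq_scaleE !nmE seminormZ.
Qed.

Let nq_norm0_eq0 u : nq_norm u = 0 -> u = 0.
Proof.
rewrite -[u]reprK nq_normE => u0; rewrite -[RHS]pi0; apply/eqP.
by rewrite normed_quotient_eq subr0 inE u0.
Qed.

HB.instance Definition _ := Lmodule_isNormed.Build K Q
  ler_nq_normD nq_normZ nq_norm0_eq0.

Lemma normed_quotient_normE x : `|[x]| = N x.
Proof. exact: nq_normE. Qed.

End SeminormKernel.

Lemma Lnorm_ae0 d (Y : measurableType d) (R : realType)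
    (mu : {measure set Y -> \bar R}) (p : R) (u : Y -> \bar R) :
  (0 < p)%R -> measurable_fun [set: Y] u ->
  {ae mu, forall y, u y = 0%E} -> ('N[mu]_p%:E[u] = 0)%E.
Proof.
move=> p0 mu_ u0; rewrite unlock /Lnorm (@ae_eq_integral _ _ _ mu _ (cst 0%E)) //.
- by rewrite integral0 poweR0r // invr_neq0 ?gt_eqF.
- apply: (measurableT_comp (measurable_poweR _)); exact: measurableT_comp.
by apply: filterS u0 => y -> _; rewrite abse0 poweR0r ?gt_eqF.
Qed.

Section RealLp.
Context d (Y : measurableType d) (R : realType).
Variables (mu : {measure set Y -> \bar R}) (p : R) (p1 : (1 <= p%:E)%E).

Let N (f : LfunType mu p1) : R := fine 'N[mu]_p%:E[EFin \o f].

Let ler_ND f g : N (f + g) <= N f + N g.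
Proof. exact: ler_LnormD. Qed.

Let NZ a f : N (a *: f) = `|a| * N f.
Proof.
by apply/EFin_inj; rewrite EFinM /N !finite_norm_fine; exact: LnormZ.
Qed.

Definition Lp_seminorm := Seminorm ler_ND NZ.

(* LfunType mu p1 consists of functions rather than classes, and LspaceType has
   no vector space structure; Lp_eqP shows that the quotient below identifies
   exactly the functions that are equal almost everywhere. *)
Definition Lp : normedModType R := normed_quotient Lp_seminorm.

Lemma Lp_eqP (f g : LfunType mu p1) :
  \pi_(normed_quotient Lp_seminorm) f = \pi g <-> f = g %[ae mu].
Proof.
rewrite (rwP eqP) normed_quotient_eq inE -(rwP eqP).
split=> [/fine_Lnormr_eq0|fg].
  by apply: filterS => y /[apply] /eqP; rewrite subr_eq0 => /eqP.
rewrite /= /N (@Lnorm_ae0 _ _ _ mu) //.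
- by rewrite (lt_le_trans ltr01) // -lee_fin.
- exact/measurable_EFinP.
apply: filterS fg => y /(_ I) fgy.
by rewrite (_ : (EFin \o _) y = (f y - g y)%:E) // fgy subrr.
Qed.

End RealLp.

Section ComplexLp.
Context d (Y : measurableType d) (R : realType).
Variables (mu : {measure set Y -> \bar R}) (p : R) (p1 : (1 <= p%:E)%E).
Implicit Types f g : Y -> R[i].

(* R[i] carries no sigma-algebra in the library; measurability of the real and
   imaginary parts is Borel measurability. The proof that 1 <= p is unused in
   the predicate, but makes the vector space structure inferable. *)
Definition Lfun_complex of (1 <= p%:E)%E : {pred Y -> R[i]} := [pred f : Y -> R[i] | `[<
  [/\ measurable_fun [set: Y] (fun y => complex.Re (f y) : R),
      measurable_fun [set: Y] (fun y => complex.Im (f y) : R) &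
      finite_norm mu p%:E (fun y => Normc.normc (f y))] >]].

Let Ref f y : R := complex.Re (f y).
Let Imf f y : R := complex.Im (f y).
Let absf f y : R := Normc.normc (f y).
Let NE f := 'N[mu]_p%:E[EFin \o absf f]%E.

Let RefD f g : Ref (f + g) = (Ref f \+ Ref g)%R.
Proof.
by apply/funext => y; rewrite /Ref !fctE /=; case: (f y) (g y) => ? ? [].
Qed.

Let ImfD f g : Imf (f + g) = (Imf f \+ Imf g)%R.
Proof.
by apply/funext => y; rewrite /Imf !fctE /=; case: (f y) (g y) => ? ? [].
Qed.

Let RefZ a f : Ref (a *: f) =
  (fun y => complex.Re a * Ref f y - complex.Im a * Imf f y).
Proof.
by apply/funext => y; rewrite /Ref /Imf !fctE /=; case: (a) (f y) => ? ? [].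
Qed.

Let ImfZ a f : Imf (a *: f) =
  (fun y => complex.Re a * Imf f y + complex.Im a * Ref f y).
Proof.
by apply/funext => y; rewrite /Ref /Imf !fctE /=; case: (a) (f y) => ? ? [].
Qed.

Let absf_ge0 f y : 0 <= absf f y.
Proof. by rewrite /absf; case: (f y) => *; rewrite sqrtr_ge0. Qed.

Let ler_absfD f g y : absf (f + g) y <= absf f y + absf g y.
Proof. exact: (@le_normcD R). Qed.

Let absfZ a f y : absf (a *: f) y = Normc.normc a * absf f y.
Proof. exact: Normc.normcM. Qed.

Let measurable_absf f : measurable_fun [set: Y] (Ref f) ->
  measurable_fun [set: Y] (Imf f) -> measurable_fun [set: Y] (absf f).
Proof.
move=> mR mI.
rewrite (_ : absf f = fun y => (Ref f y ^+ 2 + Imf f y ^+ 2) `^ 2^-1).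
  by apply: (measurableT_comp (measurable_powR _)); apply: measurable_funD;
    exact: measurable_funX.
apply/funext => y; rewrite powR12_sqrt ?addr_ge0 ?sqr_ge0 //.
by rewrite /absf /Ref /Imf; case: (f y).
Qed.

Let p0 : 0 < p.
Proof. by rewrite (lt_le_trans ltr01) // -lee_fin. Qed.

Let le_Lnorm (u v : Y -> R) :
  measurable_fun [set: Y] u -> measurable_fun [set: Y] v ->
  (forall y, 0 <= u y <= v y) ->
  ('N[mu]_p%:E[EFin \o u] <= 'N[mu]_p%:E[EFin \o v])%E.
Proof.
move=> mu_ mv uv.
have u0 y : 0 <= u y by have /andP[] := uv y.
have v0 y : 0 <= v y by have /andP[/le_trans] := uv y; apply.
rewrite unlock /Lnorm; apply: gt0_ler_poweR.
- by rewrite invr_ge0 ltW.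
- by rewrite in_itv /= leey andbT integral_ge0 // => y _; exact: poweR_ge0.
- by rewrite in_itv /= leey andbT integral_ge0 // => y _; exact: poweR_ge0.
have meas (w : Y -> R) : measurable_fun [set: Y] w ->
    measurable_fun [set: Y] (fun y => (`|(EFin \o w) y| `^ p)%E).
  move=> mw; apply: (measurableT_comp (measurable_poweR _)).
  by apply: measurableT_comp => //; exact/measurable_EFinP.
apply: ge0_le_integral => //=; [exact: meas|exact: meas|].
move=> y _; rewrite !ger0_norm // lee_fin ge0_ler_powR ?nnegrE //.
  exact: ltW.
by have /andP[] := uv y.
Qed.

Let NED f g :
  measurable_fun [set: Y] (Ref f) -> measurable_fun [set: Y] (Imf f) ->
  measurable_fun [set: Y] (Ref g) -> measurable_fun [set: Y] (Imf g) ->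
  (NE (f + g)%R <= NE f + NE g)%E.
Proof.
move=> Rf If Rg Ig.
have mf := measurable_absf Rf If; have mg := measurable_absf Rg Ig.
have NE_le : (NE (f + g)%R <= 'N[mu]_p%:E[EFin \o (absf f \+ absf g)%R])%E.
  apply: le_Lnorm => [||y]; last by rewrite absf_ge0 ler_absfD.
    by apply: measurable_absf; rewrite ?RefD ?ImfD; exact: measurable_funD.
  exact: measurable_funD.
apply: (le_trans NE_le).
by apply: eminkowski => //; exact/measurable_EFinP.
Qed.

Let NEZ a f :
  measurable_fun [set: Y] (Ref f) -> measurable_fun [set: Y] (Imf f) ->
  (NE f < +oo)%E -> (NE (a *: f)%R = (Normc.normc a)%:E * NE f)%E.
Proof.
move=> Rf If fp.
have fL : absf f \in Lfun mu p%:E.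
  by apply/andP; split; apply: mem_set => //; exact: measurable_absf.
have := LnormZ (Lfun_Sub p1 fL) (Normc.normc a).
rewrite ger0_norm; last by case: (a) => *; exact: sqrtr_ge0.
rewrite Lfun_valP => <-; congr Lnorm; apply/funext => y /=.
by rewrite absfZ.
Qed.

Let Lfun_complex_submod : submod_closed (Lfun_complex p1).
Proof.
split=> [|a f g /asboolP[Rf If fp] /asboolP[Rg Ig gp]].
  apply/asboolP; split; [exact: measurable_cst|exact: measurable_cst|].
  rewrite /finite_norm (_ : _ \o _ = cst 0%E) ?Lnorm0 ?gt_eqF //.
  by apply/funext => z; congr EFin; exact: (@Normc.normc0 R).
have Raf : measurable_fun [set: Y] (Ref (a *: f)).
  by rewrite RefZ; apply: measurable_funB; exact: measurable_funM.
have Iaf : measurable_fun [set: Y] (Imf (a *: f)).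
  by rewrite ImfZ; apply: measurable_funD; exact: measurable_funM.
apply/asboolP; split.
- by rewrite -/(Ref _) RefD; exact: measurable_funD.
- by rewrite -/(Imf _) ImfD; exact: measurable_funD.
apply: (le_lt_trans (NED Raf Iaf Rg Ig)).
rewrite lte_add_pinfty // NEZ // lte_mul_pinfty // lee_fin.
by case: (a) => *; exact: sqrtr_ge0.
Qed.

HB.instance Definition _ :=
  GRing.isSubmodClosed.Build _ _ (Lfun_complex p1) Lfun_complex_submod.

Record LfunType_complex := LfunComplex {
  Lfun_complex_fun :> Y -> R[i];
  _ : Lfun_complex_fun \in Lfun_complex p1
}.

HB.instance Definition _ := [isSub for Lfun_complex_fun].
HB.instance Definition _ := [Choice of LfunType_complex by <:].
HB.instance Definition _ := [SubChoice_isSubLmodule of LfunType_complex by <:].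

Let N (f : LfunType_complex) : R[i] := (fine (NE f))%:C%C.

Let fineNE (f : LfunType_complex) : (fine (NE f))%:E = NE f.
Proof.
rewrite fineK // ge0_fin_numE ?Lnorm_ge0 //.
by case: f => f /= /asboolP[].
Qed.

Let ler_ND (f g : LfunType_complex) : N (f + g) <= N f + N g.
Proof.
rewrite /N -rmorphD lecR -lee_fin EFinD !fineNE.
by case: f g => f /= /asboolP[? ? ?] [g /= /asboolP[? ? ?]]; exact: NED.
Qed.

Let NZ a (f : LfunType_complex) : N (a *: f) = `|a| * N f.
Proof.
rewrite /N (_ : `|a| = (Normc.normc a)%:C%C) // -rmorphM.
congr (_%:C%C); apply: EFin_inj; rewrite EFinM !fineNE.
by case: f => f /= /asboolP[? ? ?]; exact: NEZ.
Qed.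

Definition Lp_complex_seminorm := Seminorm ler_ND NZ.

Definition Lp_complex : normedModType R[i] :=
  normed_quotient Lp_complex_seminorm.

Lemma Lp_complex_eqP (f g : LfunType_complex) :
  \pi_(normed_quotient Lp_complex_seminorm) f = \pi g <-> f = g %[ae mu].
Proof.
rewrite (rwP eqP) normed_quotient_eq inE -(rwP eqP).
have fgL : ((f - g) : Y -> R[i]) \in Lfun_complex p1 by exact: valP.
have /asboolP[/measurable_absf/[apply] mfg _] := fgL.
have mN : measurable_fun [set: Y] (EFin \o absf (f - g)).
  exact/measurable_EFinP.
split=> [|fg].
  rewrite /= /N => /complexI fg0.
  have : NE (f - g) = 0%E by rewrite -fineNE fg0.
  move/Lnorm_eq0_eq0 => /(_ mN); rewrite lte_fin p0 => /(_ isT).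
  apply: filterS => y /(_ I) [] /Normc.eq0_normc /eqP.
  by rewrite subr_eq0 => /eqP.
rewrite /= /N /NE Lnorm_ae0 //.
apply: filterS fg => y /(_ I) fgy.
rewrite (_ : (EFin \o _) y = (Normc.normc (f y - g y))%:E) //.
by rewrite fgy subrr Normc.normc0.
Qed.

End ComplexLp.

(* rep_act1 and rep_actM make every rep_act g invertible, with inverse
   rep_act g^-1. Completeness of X plays no role in these definitions. *)
Record isometric_rep (K : numFieldType) (G : groupType) (X : normedModType K) :=
  IsometricRep {
    rep_act :> G -> {linear X -> X};
    rep_act1 : forall x, rep_act 1%g x = x;
    rep_actM : forall g h x, rep_act (g * h)%g x = rep_act g (rep_act h x);
    rep_act_isometry : forall g x, `|rep_act g x| = `|x|
  }.

Section Cohomology.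
Context {K : numFieldType} {G : groupType} {X : normedModType K}.
Variable pi : isometric_rep G X.

Definition cocycle (b : G -> X) : Prop :=
  forall g h, b (g * h)%g = pi g (b h) + b g.

Definition coboundary (b : G -> X) : Prop :=
  exists v, forall g, b g = v - pi g v.

Definition H1_eq0 : Prop := forall b, cocycle b -> coboundary b.

End Cohomology.

Section A2tildeGroup.
Local Open Scope group_scope.
Context {G : groupType}.
Implicit Type S : {fset G}.

(* Inverses are not needed in the words because S is assumed symmetric
   wherever this is used. *)
Definition generating S : Prop :=
  forall g : G, exists2 w : seq G, {subset w <= S} & g = \big[*%g/1]_(x <- w) x.

Definition link_graph S : rel S := fun s t => (val s)^-1 * val t \in S.

End A2tildeGroup.

(* Points and lines of the projective plane over F are the one- and
   two-dimensional subspaces of F^3. *)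
Definition proj_point (F : finFieldType) :=
  {U : {vspace 'rV[F]_3} | \dim U == 1%N}.

Definition proj_line (F : finFieldType) :=
  {U : {vspace 'rV[F]_3} | \dim U == 2%N}.

Definition incidence_graph (F : finFieldType) :
    rel (proj_point F + proj_line F)%type := fun u v =>
  match u, v with
  | inl P, inr L | inr L, inl P => (val P <= val L)%VS
  | _, _ => false
  end.

Definition graph_isomorphic (V W : Type) (e : rel V) (e' : rel W) : Prop :=
  exists2 phi : V -> W, bijective phi & {mono phi : x y / e x y >-> e' x y}.

Definition A2tilde_group (q : nat) (G : groupType) : Prop :=
  exists (F : finFieldType) (S : {fset G}),
    [/\ #|F| = q, generating S, (forall s, s \in S -> s^-1%g \in S),
        1%g \notin S & graph_isomorphic (@link_graph G S) (@incidence_graph F)].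

(* Main.v *)
(* Let alpha be the affine isometric action with linear part pi and translation
   part b. For a point x let m be the average over S of the displacements
   alpha_s x - x, and F(x) the sum over S of |alpha_s x - x|^p. Moving x to
   x + m/2 replaces the displacement at s by the midpoint of two vectors of
   norms |m - (alpha_r x - x)|, with r = s^-1, and |(alpha_s x - x) - m|, so by
   convexity F(x + m/2) is at most the sum over s of |(alpha_s x - x) - m|^p. A
   Poincare inequality for Lp-valued functions on the link graph bounds this by
   a multiple of F(x), as the displacements of x vary along a link edge (s, t)
   by an isometric copy of the displacement by s^-1 t. When the constant is
   less than 1, iterating x -> x + m/2 converges geometrically to a fixed point
   of alpha, so b is a coboundary.
   The Poincare inequality is integrated from a scalar one, which follows from
   the spectral gap 1 - sqrt q / (q + 1) of the incidence graph by comparing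
   the l^2 and l^p norms of functions on vertices and edges; the bound on p is
   what makes the resulting constant less than 1. *)
Require Import Defs.
From HB Require Import structures.
From mathcomp Require Import all_boot all_order all_algebra all_field finmap.
From mathcomp Require Import all_classical all_reals all_analysis.
From mathcomp Require Import measurable_realfun.
From mathcomp Require Import complex.
From mathcomp Require Import zify ring lra.
Set Implicit Arguments.
Unset Strict Implicit.
Unset Printing Implicit Defensive.
Import Order.TTheory GRing.Theory Num.Theory.
Import numFieldNormedType.Exports.
Local Open Scope ring_scope.

(** * The projective plane over a finite field *)

Section ProjectivePlane.
Local Open Scope nat_scope.
Variables (F : finFieldType) (T : finType) (U : T -> {vspace 'rV[F]_3}).
Hypothesis U_inj : injective U.
Hypothesis U_dim : forall t, \dim (U t) = 1%N \/ \dim (U t) = 2%N.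
Hypothesis U_surj : forall W : {vspace 'rV[F]_3},
  \dim W = 1%N \/ \dim W = 2%N -> exists t, U t = W.
Local Notation q := #|F|.

Let point t := \dim (U t) == 1%N.

Let lineE t : ~~ point t = (\dim (U t) == 2%N).
Proof. by rewrite /point; case: (U_dim t) => ->. Qed.

Let q_gt0 : (0 < q.-1)%N.
Proof. by rewrite -subn1 subn_gt0 finNzRing_gt1. Qed.

Let card_nonzero (W : {vspace 'rV[F]_3}) :
  #|[pred v in W | v != 0%R]| = (q ^ \dim W).-1.
Proof.
have -> : (q ^ \dim W = #|[pred v in W | v != 0%R]|.+1)%N; last by [].
rewrite -card_vspace (cardD1 0%R) mem0v add1n; congr S.
by apply: eq_card => v; rewrite !inE andbC.
Qed.

(** Each nonzero vector of [W] lies on exactly one point, the subspace it spans, and each point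
    carries [q.-1] of them. *)
Lemma card_points_sub (W : {vspace 'rV[F]_3}) :
  (#|[pred t | point t & (U t <= W)%VS]| * q.-1 = (q ^ \dim W).-1)%N.
Proof.
rewrite -card_nonzero -sum_nat_const -[RHS]sum1_card.
under eq_bigr => t tW.
  have -> : q.-1 = \sum_(v in [pred v in U t | v != 0%R]) 1.
    move: tW; rewrite inE => /andP[/eqP dt _].
    by rewrite sum1_card card_nonzero dt expn1.
  over.
rewrite (exchange_big_dep [pred v in W | v != 0%R]) /=; last first.
  move=> t v /andP[_ tW] /andP[vt ->]; rewrite andbT.
  exact: (subvP tW).
apply: eq_bigr => v /andP[vW v0].
have dv : \dim <[v]> = 1%N by rewrite dim_vline v0.
have [t tv] := U_surj (or_introl dv).
rewrite (bigD1 t) /=; last by rewrite !inE /point tv dv -memvE vW v0 memv_line.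
rewrite big1 ?addn0 // => t'; rewrite !inE v0 andbT.
move=> /andP[/andP[/andP[/eqP dt' _] vt'] /eqP[]]; apply: U_inj.
by apply/esym/eqP; rewrite tv eqEdim -memvE vt' dt' dv.
Qed.

Lemma card_points : #|[pred t | point t]| = (q ^ 2 + q + 1)%N.
Proof.
apply/eqP; rewrite -(eqn_pmul2r q_gt0); apply/eqP.
have := card_points_sub fullv; rewrite dimvf /dim /= mul1n => points3.
have -> : #|[pred t | point t]| = #|[pred t | point t & (U t <= fullv)%VS]|.
  by apply: eq_card => t; rewrite !inE subvf andbT.
rewrite points3; move: q_gt0; case: q => // m _.
by rewrite /= !expnS expn0; nia.
Qed.

Lemma card_points_line l : ~~ point l ->
  #|[pred t | point t & (U t <= U l)%VS]| = q.+1.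
Proof.
rewrite lineE => /eqP dl.
apply/eqP; rewrite -(eqn_pmul2r q_gt0) card_points_sub dl; apply/eqP.
have := finNzRing_gt1 F; case: q => // m _.
by rewrite /= !expnS expn0; nia.
Qed.

(** Two distinct one-dimensional subspaces meet in 0, so their sum has dimension 2 and is the only
    line containing both. *)
Lemma card_lines_points s t : point s -> point t -> s != t ->
  #|[pred l | [&& ~~ point l, (U s <= U l)%VS & (U t <= U l)%VS]]| = 1%N.
Proof.
move=> /eqP ds /eqP dt st.
have dst : \dim (U s + U t) = 2%N.
  rewrite dimv_disjoint_sum ?ds ?dt //; apply/eqP; rewrite -dimv_eq0.
  apply: contraNT st => st0; apply/eqP/U_inj.
  have := dimvS (capvSl (U s) (U t)); have := dimvS (capvSr (U s) (U t)).
  rewrite ds dt => d1 d2.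
  have dI : \dim (U s :&: U t) = 1%N by move: d1 st0; case: (\dim _) => [|[]].
  transitivity (U s :&: U t)%VS; apply/eqP.
    by rewrite eq_sym eqEdim capvSl ds dI.
  by rewrite eqEdim capvSr dt dI.
have [l lE] := U_surj (or_intror dst).
transitivity #|pred1 l|; last exact: card1.
apply: eq_card => l'; rewrite !inE -subv_add.
apply/andP/eqP => [[]|->]; last by rewrite lineE lE dst.
rewrite lineE => /eqP dl' sl'; apply: U_inj; apply/esym/eqP.
by rewrite lE eqEdim sl' dl' dst.
Qed.

(** Double counting of pairs of a line through [s] and a point [t != s] on it: each line has [q]
    such points, and each of the [q ^ 2 + q] points [t] lies on a single line with [s]. *)
Lemma card_lines_point s : point s ->
  #|[pred l | ~~ point l & (U s <= U l)%VS]| = q.+1.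
Proof.
move=> ps.
have q0 : (0 < q)%N by rewrite (ltn_trans _ (finNzRing_gt1 F)).
apply/eqP; rewrite -(eqn_pmul2r q0); apply/eqP.
transitivity (\sum_(t | point t && (t != s)) 1)%N; last first.
  rewrite sum1_card; apply: (@addnI 1).
  have cP := card_points; rewrite (cardD1 s) !inE ps in cP.
  transitivity (q ^ 2 + q + 1)%N; last by rewrite addnC expnS expn1; nia.
  rewrite -cP; congr addn; apply: eq_card => t.
  by rewrite !inE unfold_in andbC.
rewrite -sum_nat_const.
transitivity (\sum_(l | ~~ point l && (U s <= U l)%VS)
  \sum_(t | [&& point t, t != s & (U t <= U l)%VS]) 1)%N.
  apply: eq_bigr => l /andP[pl sl]; have := card_points_line pl.
  rewrite (cardD1 s) !inE ps sl => /eqP; rewrite eqSS => /eqP <-.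
  rewrite sum1_card; apply: eq_card => t; rewrite !inE.
  by rewrite andbCA.
rewrite (exchange_big_dep (fun t => point t && (t != s))) /=; last first.
  by move=> l t _ /and3P[-> ->].
apply: eq_bigr => t /andP[pt ts]; rewrite sum1_card.
rewrite -[RHS](card_lines_points ps pt); last by rewrite eq_sym.
by apply: eq_card => l; rewrite !inE unfold_in pt ts -andbA.
Qed.

End ProjectivePlane.

(** * The spectral gap of its incidence graph *)

Lemma sqrt_lt_succ (R : rcfType) (q : nat) : (0 < q)%N ->
  Num.sqrt q%:R < q.+1%:R :> R.
Proof.
move=> q_gt0; have q0 : (1 : R) <= q%:R by rewrite ler1n.
have := sqr_sqrtr (ler0n R q); have := sqrtr_ge0 (q%:R : R).
set r := Num.sqrt _; move=> r0 rr; rewrite -natr1; nra.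
Qed.

Section SpectralGap.
Variables (R : rcfType) (T : finType) (e : rel T) (point : pred T) (q : nat).
Hypothesis q_gt0 : (0 < q)%N.
Hypothesis e_sym : symmetric e.
Hypothesis e_bipartite : forall s t, e s t -> point s = ~~ point t.
Hypothesis e_regular : forall s, #|e s| = q.+1.
Hypothesis e_codegree : forall s t, point s -> point t -> s != t ->
  #|[pred l | e s l && e t l]| = 1%N.
Hypothesis card_point : #|point| = (q ^ 2 + q + 1)%N.

Let N := (q ^ 2 + q + 1)%N.

(** All degrees agree, so counting the edges from either side gives as many lines as points. *)
Lemma card_line : #|[pred l | ~~ point l]| = N.
Proof.
apply/eqP; rewrite -(eqn_pmul2r (ltn0Sn q)) /N -card_point -!sum_nat_const; apply/eqP.
under eq_bigr => l _ do rewrite -(e_regular l) -sum1_card.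
under [RHS]eq_bigr => l _ do rewrite -(e_regular l) -sum1_card.
rewrite (exchange_big_dep point) /=.
  apply: eq_bigr => s ps; apply: eq_bigl => t.
  rewrite -!topredE /= e_sym andbC.
  by apply: andb_idr => /e_bipartite; rewrite ps => <-.
by move=> l s pl /e_bipartite; rewrite (negbTE pl) => /esym/negbFE.
Qed.

Variable g : T -> R.
Hypothesis g_sum0 : \sum_s g s = 0.

Let A := \sum_(s | point s) g s.
Let SP := \sum_(s | point s) g s ^+ 2.
Let SL := \sum_(s | ~~ point s) g s ^+ 2.
(** The adjacency operator applied to [g], to be evaluated at lines. *)
Let w l := \sum_(s | e l s) g s.

Let sum_line : \sum_(l | ~~ point l) g l = - A.
Proof.
move: g_sum0; rewrite (bigID point) /= addrC => /eqP.
by rewrite addr_eq0 => /eqP.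
Qed.

Let sum_adj (F : T -> T -> R) :
  \sum_(l | ~~ point l) \sum_(s | e l s) F l s =
  \sum_(s | point s) \sum_(l | e s l) F l s.
Proof.
rewrite (exchange_big_dep point) /=.
  apply: eq_bigr => s ps; apply: eq_bigl => l; rewrite e_sym andbC.
  by apply: andb_idr => /e_bipartite; rewrite ps => <-.
by move=> l s pl /e_bipartite; rewrite (negbTE pl) => /esym/negbFE.
Qed.

Let sum_w : \sum_(l | ~~ point l) w l = q.+1%:R * A.
Proof.
rewrite sum_adj mulr_sumr; apply: eq_bigr => s _.
by rewrite sumr_const e_regular mulr_natl.
Qed.

(** Expanding the square weights each pair of points by the number of lines through both: [q.+1] on
    the diagonal and 1 off it. *)
Let sum_w2 : \sum_(l | ~~ point l) w l ^+ 2 = q%:R * SP + A ^+ 2.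
Proof.
transitivity (\sum_(s | point s) \sum_(t | point t)
    g s * g t * #|[pred l | e s l && e t l]|%:R).
  under eq_bigr => l _ do rewrite expr2 /w mulr_suml.
  rewrite sum_adj; apply: eq_bigr => s ps.
  under eq_bigr => l _ do rewrite mulr_sumr.
  rewrite (exchange_big_dep point) /=.
    apply: eq_bigr => t pt; rewrite sumr_const mulr_natr.
    congr (_ *+ _); apply: eq_card => l.
    by rewrite !inE unfold_in (e_sym l).
  move=> l t /e_bipartite + /e_bipartite; rewrite ps => /esym/negbTE ->.
  by move=> /esym/negbFE.
rewrite expr2 {1}/A mulr_suml mulr_sumr -big_split; apply: eq_bigr => s ps /=.
rewrite (bigD1 s) //= [A in RHS](bigD1 s) //= mulrDr addrA -expr2; congr (_ + _).
  rewrite (_ : #|_| = q.+1); first by rewrite -natr1; ring.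
  by rewrite -(e_regular s); apply: eq_card => l; rewrite !inE andbb.
rewrite mulr_sumr; apply: eq_bigr => t /andP[pt ts].
by rewrite e_codegree // ?mulr1 // eq_sym.
Qed.

(** By bipartiteness the sum is twice the pairing [B] of [g] with [w] over the lines. Expanding a
    sum of squares over the lines bounds [2 * r * B] by [q * (SP + SL)], since [sum_w2] evaluates
    the norm of [w]. *)
Lemma sum_adjacent_le :
  \sum_s \sum_(t | e s t) g s * g t <= Num.sqrt q%:R * \sum_s g s ^+ 2.
Proof.
set r := Num.sqrt q%:R.
have r0 : 0 < r by rewrite sqrtr_gt0 ltr0n.
have rr : r ^+ 2 = q%:R by rewrite sqr_sqrtr // ler0n.
pose B := \sum_(l | ~~ point l) g l * w l.
have -> : \sum_s \sum_(t | e s t) g s * g t = 2 * B.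
  rewrite (bigID point) /= mulr2n mulrDl mul1r; congr (_ + _).
    rewrite /B; under [RHS]eq_bigr => l _ do rewrite mulr_sumr.
    rewrite sum_adj; apply: eq_bigr => s _; apply: eq_bigr => t _.
    exact: mulrC.
  by apply: eq_bigr => l _; rewrite mulr_sumr.
rewrite (bigID point) /= -/SP -/SL.
pose n : R := q%:R ^+ 2 + q%:R + 1.
have n0 : 0 < n by rewrite /n; have := ler0n R q; nra.
pose c := (r + q.+1%:R) * A / n.
(* [r * g - w + c] is [r * g - w] recentered to mean zero over the lines. *)
have : 0 <= \sum_(l | ~~ point l) (r * g l - w l + c) ^+ 2.
  by apply: sumr_ge0 => l _; exact: sqr_ge0.
have -> : \sum_(l | ~~ point l) (r * g l - w l + c) ^+ 2 =
    \sum_(l | ~~ point l) (r ^+ 2 * g l ^+ 2 + w l ^+ 2 + c ^+ 2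
      + (- (2 * r)) * (g l * w l) + (2 * c * r) * g l + (- (2 * c)) * w l).
  by apply: eq_bigr => l _; ring.
rewrite !big_split /= sumr_const card_line -!mulr_sumr sum_line sum_w sum_w2.
rewrite -/SL -/B -[c ^+ 2 *+ _]mulr_natr.
have -> : N%:R = n by rewrite /N /n !natrD natrX.
have cn : c * n = (r + q.+1%:R) * A by rewrite /c divfK // gt_eqF.
have -> : c ^+ 2 * n = c * ((r + q.+1%:R) * A) by rewrite -cn; ring.
(* The expansion contains the term [A ^+ 2] of [sum_w2]; the recentering compensates it because n <=
   (r + q + 1)^2. *)
have cA : A ^+ 2 <= c * ((r + q.+1%:R) * A).
  rewrite /c mulrAC ler_pdivlMr // -expr2 exprMn mulrC ler_wpM2r ?sqr_ge0 //.
  by rewrite -natr1 /n -rr; nra.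
rewrite rr -natr1; rewrite -natr1 in cA => le0.
rewrite -(ler_pM2l r0); have -> : r * (r * (SP + SL)) = q%:R * (SP + SL).
  by rewrite -rr; ring.
by lra.
Qed.

(** Expanding the squares, regularity evaluates the diagonal terms and [sum_adjacent_le] bounds the
    cross terms. *)
Lemma poincare_l2_mean0 :
  2 * (q.+1%:R - Num.sqrt q%:R) * (\sum_s g s ^+ 2) <=
  \sum_s \sum_(t | e s t) (g s - g t) ^+ 2.
Proof.
have -> : \sum_s \sum_(t | e s t) (g s - g t) ^+ 2 =
    2 * (q.+1%:R * \sum_s g s ^+ 2) - 2 * \sum_s \sum_(t | e s t) g s * g t.
  rewrite [2 * (q.+1%:R * _)]mulr_natl mulr2n.
  have {1}-> : q.+1%:R * (\sum_s g s ^+ 2) = \sum_s \sum_(t | e s t) g s ^+ 2.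
    rewrite mulr_sumr; apply: eq_bigr => s _.
    by rewrite sumr_const e_regular mulr_natl.
  have -> : q.+1%:R * (\sum_s g s ^+ 2) = \sum_s \sum_(t | e s t) g t ^+ 2.
    rewrite (exchange_big_dep predT) //= mulr_sumr; apply: eq_bigr => t _.
    rewrite sumr_const -(e_regular t) mulr_natl; congr (_ *+ _).
    by apply: eq_card => s; rewrite unfold_in e_sym.
  rewrite mulr_sumr -!big_split -sumrB; apply: eq_bigr => s _ /=.
  rewrite mulr_sumr -!big_split -sumrB; apply: eq_bigr => t _ /=.
  ring.
have := sum_adjacent_le; lra.
Qed.

End SpectralGap.

(** * The l^2 Poincare inequality on the incidence graph *)

Section IncidenceGraph.
Variables (F : finFieldType) (T : finType) (e : rel T).
Hypothesis e_incidence : graph_isomorphic e (@incidence_graph F).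

Local Notation q := #|F|.

(** These are the combinatorial hypotheses of the spectral gap. The subspace counts are carried
    along the isomorphism, a vertex being a point or a line according to the dimension of its
    subspace. *)
Lemma incidence_graph_structure : exists point : pred T,
  [/\ symmetric e, (forall s t, e s t -> point s = ~~ point t),
      (forall s, #|e s| = q.+1),
      (forall s t, point s -> point t -> s != t ->
        #|[pred l | e s l && e t l]| = 1%N) &
      #|point| = (q ^ 2 + q + 1)%N].
Proof.
have [phi phi_bij phi_e] := e_incidence.
pose sub (x : proj_point F + proj_line F) : {vspace 'rV[F]_3} :=
  match x with inl P => val P | inr L => val L end.
pose U t := sub (phi t).
have sub_dim x : \dim (sub x) = 1%N \/ \dim (sub x) = 2%N.
  by case: x => [P|L]; [left; exact/eqP/(valP P)|right; exact/eqP/(valP L)].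
have sub_inj : injective sub.
  move=> [P|L] [P'|L'] //=; try by move=> /val_inj ->.
    by move=> PL; have := valP L'; rewrite /= -PL (eqP (valP P)).
  by move=> LP; have := valP L; rewrite /= LP (eqP (valP P')).
have U_inj : injective U by move=> s t /sub_inj /(bij_inj phi_bij).
have U_dim t : \dim (U t) = 1%N \/ \dim (U t) = 2%N by exact: sub_dim.
have U_surj (W : {vspace 'rV[F]_3}) :
    \dim W = 1%N \/ \dim W = 2%N -> exists t, U t = W.
  have [psi _ phiK] := phi_bij.
  case=> /eqP dW.
    by exists (psi (inl (exist _ W dW))); rewrite /U phiK.
  by exists (psi (inr (exist _ W dW))); rewrite /U phiK.
pose point t := \dim (U t) == 1%N.
have eE s t : e s t = [&& point s, ~~ point t & (U s <= U t)%VS] ||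
    [&& ~~ point s, point t & (U t <= U s)%VS].
  rewrite -phi_e /point /U; case: (phi s) (phi t) => [P|L] [P'|L'] /=.
  - by rewrite !(eqP (valP P)) !(eqP (valP P')).
  - by rewrite !(eqP (valP P)) !(eqP (valP L')) orbF.
  - by rewrite !(eqP (valP L)) !(eqP (valP P')).
  - by rewrite !(eqP (valP L)) !(eqP (valP L')).
exists point; split.
- by move=> s t; rewrite !eE orbC; congr orb; rewrite andbCA.
- by move=> s t; rewrite eE; case: (point s) (point t) => -[].
- move=> s; have [ps|ps] := boolP (point s).
    rewrite -(card_lines_point U_inj U_dim U_surj ps); apply: eq_card => t.
    by rewrite !inE unfold_in eE ps /= orbF.
  rewrite -(card_points_line U_inj U_dim U_surj ps); apply: eq_card => t.
  by rewrite !inE unfold_in eE (negbTE ps).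
- move=> s t ps pt st; rewrite -(card_lines_points U_inj U_dim U_surj ps pt st).
  apply: eq_card => l; rewrite !inE !eE ps pt /= !orbF.
  by rewrite -/(point l); case: (point l).
- exact: (card_points U_inj U_surj).
Qed.

Variable R : rcfType.

Lemma incidence_graph_poincare_l2 (f : T -> R) :
  \sum_s (f s - #|T|%:R^-1 * \sum_t f t) ^+ 2 <=
  (2 * (q.+1%:R - Num.sqrt q%:R))^-1 *
    \sum_s \sum_(t | e s t) (f s - f t) ^+ 2.
Proof.
have [point [e_sym e_bip e_reg e_codeg card_pt]] := incidence_graph_structure.
have q_gt0 : (0 < q)%N by rewrite (ltn_trans _ (finNzRing_gt1 F)).
pose M : R := #|T|%:R^-1 * \sum_t f t.
have T_gt0 : (0 < #|T|)%N.
  by apply: leq_trans (max_card point); rewrite card_pt addn1.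
have g0 : \sum_s (f s - M) = 0.
  rewrite sumrB sumr_const -[M *+ _]mulr_natl /M mulrA mulfV ?mul1r ?subrr //.
  by rewrite pnatr_eq0 -lt0n.
have := poincare_l2_mean0 q_gt0 e_sym e_bip e_reg e_codeg card_pt g0.
under [X in _ <= X -> _]eq_bigr => s _ do under eq_bigr => t _ do
  rewrite opprB addrA subrK.
by rewrite ler_pdivlMl // mulr_gt0 // subr_gt0 sqrt_lt_succ.
Qed.

Lemma incidence_graph_regular s : #|[pred t | e s t]| = q.+1.
Proof.
by have [point [_ _ e_reg _ _]] := incidence_graph_structure; rewrite -(e_reg s).
Qed.

(** Edges are counted with orientation, to match the double sums over adjacent [s] and [t]. *)
Lemma card_incidence_graph :
  #|[pred st : T * T | e st.1 st.2]| = (2 * (q ^ 2 + q + 1) * q.+1)%N.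
Proof.
have [point [e_sym e_bip e_reg e_codeg card_pt]] := incidence_graph_structure.
rewrite -sum1_card; transitivity (\sum_s \sum_(t | e s t) 1)%N.
  by rewrite pair_big_dep.
under eq_bigr => s _ do rewrite sum1_card incidence_graph_regular.
rewrite sum_nat_const -(cardC point) card_pt.
by rewrite (card_line e_sym e_bip e_reg card_pt) addnn mul2n.
Qed.

End IncidenceGraph.

(** * Poincare inequalities with exponent p *)

Section PowerSums.
Variables (R : realType) (I : finType) (P : pred I) (x : I -> R) (r : R).
Hypothesis r_ge1 : 1 <= r.
Hypothesis x_ge0 : forall i, 0 <= x i.

Let r_gt0 : 0 < r. Proof. exact: lt_le_trans r_ge1. Qed.

Let sum_eq0 : \sum_(i | P i) x i = 0 -> forall i, P i -> x i = 0.
Proof. by move=> + i Pi => /psumr_eq0P ->. Qed.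

(** With S the sum, x_i^r = x_i x_i^(r-1) <= x_i S^(r-1). *)
Lemma sum_powR_le : \sum_(i | P i) x i `^ r <= (\sum_(i | P i) x i) `^ r.
Proof.
set S := \sum_(i | P i) x i.
have [S0|S0] := eqVneq S 0.
  by rewrite big1 ?powR_ge0 // => i Pi; rewrite sum_eq0 // powR0 // gt_eqF.
have Sge0 : 0 <= S by apply: sumr_ge0.
rewrite -mulr_powRB1 // {1}/S mulr_suml; apply: ler_sum => i Pi.
rewrite -mulr_powRB1 // ler_wpM2l // ge0_ler_powR ?nnegrE ?subr_ge0 //.
by rewrite /S (bigD1 i) //= lerDl sumr_ge0.
Qed.

(** The power mean inequality. Young's inequality x a^(r-1) <= x^r / r + (1 - 1/r) a^r is summed
    with [a] the mean of the family, where it is sharp for constant families. *)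
Lemma powR_sum_le : (\sum_(i | P i) x i) `^ r <=
  #|P|%:R `^ (r - 1) * \sum_(i | P i) x i `^ r.
Proof.
set S := \sum_(i | P i) x i.
have X0 : 0 <= \sum_(i | P i) x i `^ r.
  by apply: sumr_ge0 => i _; exact: powR_ge0.
have [S0|S0] := eqVneq S 0.
  by rewrite S0 powR0 ?mulr_ge0 ?powR_ge0 // gt_eqF.
have Sge0 : 0 <= S by apply: sumr_ge0.
have n0 : 0 < #|P|%:R :> R.
  rewrite ltr0n; apply: contraNltn S0; rewrite leqn0 => /eqP/card0_eq P0.
  by rewrite /S big_pred0.
(* The conjugate exponent [r / (r - 1)] used below requires [r] to differ from 1. *)
have [->|r1] := eqVneq r 1.
  rewrite subrr powRr0 mul1r powRr1 // /S le_eqVlt; apply/orP; left.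
  by apply/eqP/eq_bigr => i _; rewrite powRr1.
have {}r1 : 1 < r by rewrite lt_neqAle eq_sym r1.
set n : R := #|P|%:R; pose a := S / n.
have a0 : 0 <= a by rewrite divr_ge0 // ltW.
have young i : x i * a `^ (r - 1) <= x i `^ r / r + a `^ r / (r / (r - 1)).
  rewrite (_ : a `^ r = (a `^ (r - 1)) `^ (r / (r - 1))).
    apply: conjugate_powR; rewrite ?powR_ge0 // ?divr_gt0 ?subr_gt0 //.
    by rewrite invf_div; field; rewrite gt_eqF.
  by rewrite -powRrM; congr powR; field; rewrite subr_eq0 gt_eqF.
have : \sum_(i | P i) x i * a `^ (r - 1) <=
    \sum_(i | P i) (x i `^ r / r + a `^ r / (r / (r - 1))).
  by apply: ler_sum => i _; exact: young.
rewrite -mulr_suml big_split /= -mulr_suml sumr_const -(mulr_natr (a `^ r / _)).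
rewrite -/S -/n.
(* The left side becomes n a^r, which absorbs the term (1 - 1/r) n a^r of the right side. *)
have Sa : S = n * a by rewrite /a mulrC divfK // gt_eqF.
rewrite {1}Sa -mulrA mulr_powRB1 // => le.
have {le} : n * a `^ r <= \sum_(i | P i) x i `^ r.
  move: le; rewrite invf_div => le.
  have : n * a `^ r / r <= (\sum_(i | P i) x i `^ r) / r.
    rewrite -subr_ge0; move: le; rewrite -subr_ge0; congr (0 <= _).
    by field; rewrite gt_eqF.
  by rewrite ler_pM2r // invr_gt0.
move=> le; have n_ge0 := ltW n0.
rewrite -/n Sa powRM // -(mulr_powRB1 n_ge0 r_gt0).
by rewrite mulrAC [X in X <= _]mulrC ler_wpM2l ?powR_ge0.
Qed.

End PowerSums.

(** For the squares and the exponent [p / 2], [sum_powR_le] treats the left side and [powR_sum_le]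
    the right side, at the cost of a power of [#|P|]. *)
Lemma lp_le_of_l2_le (R : realType) (I J : finType) (P : pred J)
    (u : I -> R) (v : J -> R) (k p : R) :
  2 <= p -> 0 <= k -> (forall i, 0 <= u i) -> (forall j, 0 <= v j) ->
  \sum_i u i ^+ 2 <= k * \sum_(j | P j) v j ^+ 2 ->
  \sum_i u i `^ p <=
  k `^ (p / 2) * #|P|%:R `^ (p / 2 - 1) * \sum_(j | P j) v j `^ p.
Proof.
move=> p2 k0 u0 v0 uv.
have r1 : 1 <= p / 2 by lra.
have powE x : 0 <= x -> x `^ p = (x ^+ 2) `^ (p / 2).
  by move=> x0; rewrite -powR_mulrn // -powRrM mulrC divfK.
under eq_bigr do rewrite powE //.
under [X in _ <= _ * X]eq_bigr do rewrite powE //.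
apply: (le_trans (sum_powR_le _ r1 _)) => [i|]; first exact: sqr_ge0.
have sv0 : 0 <= \sum_(j | P j) v j ^+ 2.
  by apply: sumr_ge0 => j _; exact: sqr_ge0.
apply: (@le_trans _ _ ((k * \sum_(j | P j) v j ^+ 2) `^ (p / 2))).
  apply: ge0_ler_powR; rewrite ?nnegrE ?mulr_ge0 //; first lra.
  by apply: sumr_ge0 => i _; exact: sqr_ge0.
rewrite powRM // -mulrA ler_wpM2l ?powR_ge0 //.
by apply: powR_sum_le => // j; exact: sqr_ge0.
Qed.

(** * The numerical condition on the exponent *)

Section Exponent.
Variables (R : realType) (q : nat) (p : R).
Hypothesis q_gt0 : (0 < q)%N.
Hypothesis p_ge2 : 2 <= p.

(* The l^2 constant to the power p/2, times the power p/2 - 1 of the number of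
   oriented edges, which comes from comparing the l^2 and l^p norms. *)
Definition poincare_const : R :=
  ((2 * (q.+1%:R - Num.sqrt q%:R))^-1) `^ (p / 2) *
  (2 * (q ^ 2 + q + 1) * q.+1)%:R `^ (p / 2 - 1).

(** The factor [q.+1] is the degree of the link graph, which enters through [energy_link]. In
    logarithms the claim reads (p/2) (ln n - ln lam) < ln n + ln 2. The bound on [p] gives this with
    the extra term (p/2 - 1) (ln D - ln 2) on the left, which is nonnegative. *)
Lemma poincare_const_lt1 :
  p < (ln (q%:R ^+ 2 + q%:R + 1) + ln (q%:R + 1)) /
    (2^-1 * ln (2 * (q%:R ^+ 2 + q%:R + 1) * (q%:R + 1)) - ln 2
       - ln (Num.sqrt (1 - Num.sqrt q%:R / (q%:R + 1)))) ->
  poincare_const * q.+1%:R < 1.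
Proof.
have q1 : (1 : R) <= q%:R by rewrite ler1n.
have := sqrt_lt_succ R q_gt0; rewrite -(@natr1 _ q) => rq.
set D : R := q%:R + 1 in rq *; set n : R := q%:R ^+ 2 + q%:R + 1.
set lam := 1 - _.
have D2 : 2 <= D by rewrite /D; lra.
have D0 : 0 < D by lra.
have n0 : 0 < n by rewrite /n; nra.
have lam0 : 0 < lam by rewrite subr_gt0 ltr_pdivrMr // mul1r.
have Dlam : D - Num.sqrt q%:R = D * lam.
  by rewrite /lam; field; rewrite gt_eqF.
have lnsq : ln (Num.sqrt lam) = 2^-1 * ln lam.
  by rewrite -powR12_sqrt ?ltW // ln_powR.
rewrite lnsq !lnM ?posrE ?mulr_gt0 //.
set b := _ - _ - _ => pb.
have n1 : 1 <= n by rewrite /n; nra.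
have a0 : 0 <= ln n + ln D by rewrite addr_ge0 // ln_ge0 //; lra.
(* For [b <= 0] the quotient would be at most 0, also at [b = 0], where inversion returns 0. *)
have b0 : 0 < b.
  rewrite ltNge; apply/negP => b0; suff : p <= 0 by move: p_ge2; lra.
  by rewrite (le_trans (ltW pb)) // mulr_ge0_le0 // invr_le0.
move: pb; rewrite ltr_pdivlMr // => pb.
rewrite /poincare_const -(@natr1 _ q) Dlam -/D !natrM !natrD natrX -/n -(@natr1 _ q) -/D.
rewrite -ltr_ln ?posrE ?ltr01 //; last first.
  by rewrite !mulr_gt0 ?powR_gt0 ?invr_gt0 ?mulr_gt0.
rewrite ln1 !lnM ?posrE ?mulr_gt0 ?powR_gt0 ?invr_gt0 ?mulr_gt0 //.
rewrite !ln_powR lnV ?posrE ?mulr_gt0 // !lnM ?posrE ?mulr_gt0 //.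
have : ln 2 <= ln D by rewrite ler_ln ?posrE.
rewrite /b in pb; move: pb.
set lD := ln D; set l2 := ln 2; set ln_ := ln n; set ll := ln lam => pb l2D.
have : (p / 2 - 1) * l2 <= (p / 2 - 1) * lD by rewrite ler_wpM2l //; move: p_ge2; lra.
lra.
Qed.

End Exponent.

(** * The fixed point argument *)

Lemma powR_rootK (R : realType) (p x : R) : p != 0 -> 0 <= x ->
  (x `^ p) `^ p^-1 = x.
Proof. by move=> p0 x0; rewrite -powRrM mulfV // powRr1. Qed.

Lemma powR_half_le (R : realType) (p a b : R) : 1 <= p -> 0 <= a -> 0 <= b ->
  (2^-1 * (a + b)) `^ p <= 2^-1 * (a `^ p + b `^ p).
Proof.
move=> p1 a0 b0; rewrite !mulrDr.
rewrite [X in _ + X * b](_ : 2^-1 = 1 - 2^-1); last by lra.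
rewrite [X in _ + X * b `^ p](_ : 2^-1 = 1 - 2^-1); last by lra.
by apply: (convex_powR p1 (Itv01 _ _)) => //=;
  rewrite ?inE/= ?in_itv/= ?a0 ?b0// ?invr_ge0// invf_le1 ?ler1n.
Qed.

Lemma le_geometric_le0 (R : realType) (a c r : R) : 0 <= r -> r < 1 ->
  (forall n, a <= c * r ^+ n) -> a <= 0.
Proof.
move=> r0 r1 ac; have rn : `|r| < 1 by rewrite ger0_norm.
have /cvg_lim <- // := cvg_geometric c rn.
apply: limr_ge; first by apply/cvg_ex; exists 0; exact: cvg_geometric.
by apply: nearW => n; exact: ac.
Qed.

Definition mean (K : numFieldType) (V : lmodType K) (I : finType)
  (f : I -> V) : V := #|I|%:R^-1 *: \sum_i f i.

(* [iota] is the inclusion of R into K = R or R[i], where norms are valued. *)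
Section FixedPoint.
Variables (R : realType) (K : numFieldType) (iota : {rmorphism R -> K}).
Hypothesis iota_le : {mono iota : x y / x <= y}.
Variables (X : normedModType K) (nrm : X -> R).
Hypothesis normE : forall x, `|x| = iota (nrm x).
(** Completeness in the form that the iteration uses: geometrically decaying steps give a limit
    approached at the same rate. *)
Hypothesis X_complete : forall (u : nat -> X) (a r : R), 0 <= r -> r < 1 ->
  (forall n, nrm (u n.+1 - u n) <= a * r ^+ n) ->
  exists x c, forall n, nrm (u n - x) <= c * r ^+ n.

Variables (G : groupType) (S : {fset G}) (D : nat) (p C : R).
Hypothesis S_generating : generating S.
Hypothesis S_sym : forall s, s \in S -> s^-1%g \in S.
Hypothesis S_regular : forall s : S, #|[pred t : S | link_graph s t]| = D.
Hypothesis p_ge1 : 1 <= p.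
Hypothesis C_ge0 : 0 <= C.
Hypothesis CD_lt1 : C * D%:R < 1.

Hypothesis poincare : forall f : S -> X,
  \sum_s nrm (f s - mean f) `^ p <=
  C * \sum_s \sum_(t | link_graph s t) nrm (f s - f t) `^ p.

Variables (pi : isometric_rep G X) (b : G -> X).
Hypothesis b_cocycle : cocycle pi b.

Let p_gt0 : 0 < p. Proof. exact: lt_le_trans p_ge1. Qed.

Let iota_inj : injective iota.
Proof. by move=> x y xy; apply/eqP; rewrite eq_le -!iota_le xy lexx. Qed.

Let nrm_ge0 x : 0 <= nrm x.
Proof. by rewrite -iota_le rmorph0 -normE. Qed.

Let nrm_eq0 x : nrm x <= 0 -> x = 0.
Proof. by rewrite -iota_le rmorph0 -normE normr_le0 => /eqP. Qed.

Let nrmD x y : nrm (x + y) <= nrm x + nrm y.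
Proof. by rewrite -iota_le rmorphD -!normE ler_normD. Qed.

Let nrmN x : nrm (- x) = nrm x.
Proof. by apply: iota_inj; rewrite -!normE normrN. Qed.

Let nrmB x y : nrm (x - y) = nrm (y - x).
Proof. by rewrite -nrmN opprB. Qed.

Let nrm_pi g x : nrm (pi g x) = nrm x.
Proof. by apply: iota_inj; rewrite -!normE rep_act_isometry. Qed.

Let nrmVn n x : nrm (n%:R^-1 *: x) = n%:R^-1 * nrm x.
Proof.
apply: iota_inj; rewrite -!normE normrZ rmorphM -normE fmorphV rmorph_nat.
by rewrite ger0_norm // invr_ge0 ler0n.
Qed.

Let nrm_sum (I : finType) (f : I -> X) : nrm (\sum_i f i) <= \sum_i nrm (f i).
Proof.
by rewrite -iota_le -normE rmorph_sum (le_trans (ler_norm_sum _ _ _)) //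
  ler_sum // => i _; rewrite normE.
Qed.

(** As a function of [g] this is [b] minus the coboundary of [x], hence again a cocycle. *)
Definition displacement (x : X) (g : G) : X := pi g x + b g - x.
Local Notation disp := displacement.

Let b1 : b 1%g = 0.
Proof.
have := b_cocycle 1%g 1%g; rewrite mulg1 rep_act1 => /eqP.
by rewrite -subr_eq subrr eq_sym => /eqP.
Qed.

Let dispM x g h : disp x (g * h)%g = pi g (disp x h) + disp x g.
Proof.
rewrite /disp b_cocycle rep_actM linearB linearD /=.
by rewrite !addrA subrK.
Qed.

Let disp1 x : disp x 1%g = 0.
Proof. by rewrite /disp rep_act1 b1 addr0 subrr. Qed.

Let dispV x g : pi g^-1%g (disp x g) = - disp x g^-1%g.
Proof. by apply/eqP; rewrite -addr_eq0 -dispM mulVg disp1. Qed.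

Definition energy (x : X) : R := \sum_(s : S) nrm (disp x (val s)) `^ p.

Let energy_ge0 x : 0 <= energy x.
Proof. by apply: sumr_ge0 => s _; exact: powR_ge0. Qed.

Let invS (s : S) : S := [` S_sym (valP s)]%fset.

Let invSK : involutive invS.
Proof. by move=> s; apply: val_inj; rewrite /= invgK. Qed.

Let link_sym (s t : S) : link_graph s t = link_graph t s.
Proof.
rewrite /link_graph; apply/idP/idP => /S_sym;
  by rewrite invgM invgK.
Qed.

(** Writing membership in [S] as a sum over [S] turns conditions on products of generators into sums
    that can be exchanged. *)
Let sum_val_eq (g : G) (phi : G -> R) :
  \sum_(u : S | val u == g) phi (val u) = if g \in S then phi g else 0.
Proof.
case: ifPn => gS; last first.
  by rewrite big_pred0 // => u; apply: contraNF gS => /eqP <-; exact: valP.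
by rewrite (big_pred1 [` gS]%fset) // => u; rewrite -val_eqE.
Qed.

(* Along a link edge the displacements differ by an isometric copy of the
   displacement by [s^-1 * t], and each generator is of this form [D] times. *)
Lemma energy_link x :
  \sum_(s : S) \sum_(t : S | link_graph s t)
    nrm (disp x (val s) - disp x (val t)) `^ p = D%:R * energy x.
Proof.
pose phi g := nrm (disp x g) `^ p.
have edge (s t : S) :
    nrm (disp x (val s) - disp x (val t)) = nrm (disp x ((val s)^-1 * val t)%g).
  rewrite -{1}(mulVKg (val s) (val t)) dispM opprD addrCA subrr addr0.
  by rewrite nrmN nrm_pi.
(* The variable u = s^-1 t replaces [t]; that s u lies in [S] means that s^-1 and [u] are adjacent
   in the link graph. *)
transitivity (\sum_(s : S) \sum_(u : S | link_graph (invS s) u) phi (val u)).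
  apply: eq_bigr => s _; rewrite big_mkcond [RHS]big_mkcond /=.
  transitivity (\sum_(t : S)
      \sum_(u : S | val u == ((val s)^-1 * val t)%g) phi (val u)).
    by apply: eq_bigr => t _; rewrite sum_val_eq edge.
  rewrite (exchange_big_dep predT) //=; apply: eq_bigr => u _.
  transitivity (\sum_(t : S | val t == (val s * val u)%g) phi (val u)).
    by apply: eq_bigl => t; apply/eqP/eqP => /= tE; rewrite /= tE (mulKg, mulVKg).
  by rewrite (sum_val_eq _ (fun=> phi (val u))) /link_graph /= invgK.
rewrite (reindex_inj (inv_inj invSK)) /=.
under eq_bigr => s _ do under eq_bigl do rewrite invSK.
rewrite (exchange_big_dep predT) //= /energy mulr_sumr; apply: eq_bigr => u _.
rewrite sumr_const -(S_regular u) mulr_natl; congr (_ *+ _).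
by apply: eq_card => s; rewrite !inE unfold_in link_sym.
Qed.

Lemma energy_step x (m := mean (fun s : S => disp x (val s))) :
  energy (x + 2^-1 *: m) <= \sum_(s : S) nrm (disp x (val s) - m) `^ p.
Proof.
(* Moving [x] by m/2 adds (pi_s m - m)/2 to the displacement, which makes it a midpoint. *)
have step (s : S) : disp (x + 2^-1 *: m) (val s) =
    2^-1 *: (disp x (val s) + pi (val s) m) + 2^-1 *: (disp x (val s) - m).
  rewrite -scalerDr addrACA -mulr2n -(scaler_nat 2 (disp _ _)) scalerDr (scalerA _ 2).
  rewrite mulVf ?pnatr_eq0 // scale1r scalerBr /disp linearD linearZ /= opprD.
  by rewrite [pi _ x + _ + _]addrAC addrACA.
pose A (s : S) := nrm (disp x (val s) - m) `^ p.
(* The isometry at s^-1 sends this vector to [m] minus the displacement at s^-1, by [dispV]. *)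
have AE (s : S) : nrm (disp x (val s) + pi (val s) m) `^ p = A (invS s).
  rewrite /A -(nrm_pi (val s)^-1%g) linearD /= dispV -rep_actM mulVg rep_act1.
  by rewrite addrC nrmB.
have -> : \sum_s A s = \sum_s 2^-1 * (A (invS s) + A s).
  rewrite -mulr_sumr big_split /= (_ : \sum_s A (invS s) = \sum_s A s).
    by rewrite -mulr2n -[X in _ = _ * X]mulr_natl mulKf ?pnatr_eq0.
  by rewrite [RHS](reindex_inj (inv_inj invSK)).
apply: ler_sum => s _; rewrite step -scalerDr nrmVn -AE.
apply: le_trans (powR_half_le p_ge1 (nrm_ge0 _) (nrm_ge0 _)).
rewrite ge0_ler_powR ?nnegrE ?mulr_ge0 ?invr_ge0 ?addr_ge0 ?(ltW p_gt0) //.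
by rewrite ler_wpM2l ?invr_ge0.
Qed.

Let rho := C * D%:R.

Let rho_ge0 : 0 <= rho. Proof. by rewrite mulr_ge0 ?ler0n. Qed.

Let next x := x + 2^-1 *: mean (fun s : S => disp x (val s)).

Lemma energy_next x : energy (next x) <= rho * energy x.
Proof.
apply: le_trans (energy_step x) _.
by apply: le_trans (poincare _) _; rewrite energy_link mulrA.
Qed.

Let nrm_disp_le x (s : S) : nrm (disp x (val s)) <= energy x `^ p^-1.
Proof.
rewrite -[leLHS](@powR_rootK _ p) ?gt_eqF //.
rewrite ge0_ler_powR ?nnegrE ?powR_ge0 ?invr_ge0 ?(ltW p_gt0) //.
by rewrite /energy (bigD1 s) //= lerDl sumr_ge0 // => t _; exact: powR_ge0.
Qed.

Lemma nrm_mean_le (f : S -> X) M :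
  0 <= M -> (forall s, nrm (f s) <= M) -> nrm (mean f) <= M.
Proof.
(* For empty [S] the mean is 0, as the inverse of 0 is 0. *)
move=> M0 fM; rewrite /mean nrmVn; have [S0|S0] := posnP #|{: S}|.
  by rewrite S0 invr0 mul0r.
rewrite ler_pdivrMl ?ltr0n // (le_trans (nrm_sum _)) //.
apply: (le_trans (ler_sum _ (fun s _ => fM s))).
by rewrite sumr_const mulr_natl.
Qed.

Lemma fixed_point : exists x, forall s : S, disp x (val s) = 0.
Proof.
(* The energy is a sum of p-th powers, so its decay rate [rho] yields the rate [r] for the
   displacements. *)
pose u n := iter n next 0; pose a := energy 0 `^ p^-1; pose r := rho `^ p^-1.
have r0 : 0 <= r by exact: powR_ge0.
have pV0 : 0 < p^-1 by rewrite invr_gt0.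
have r1 : r < 1.
  by have := gt0_ltr_powR pV0 rho_ge0 ler01 CD_lt1; rewrite powR1.
have a0 : 0 <= a by exact: powR_ge0.
have energy_u n : energy (u n) <= rho ^+ n * energy 0.
  elim: n => [|n IHn]; first by rewrite expr0 mul1r.
  by rewrite exprS -mulrA (le_trans (energy_next _)) // ler_wpM2l.
have disp_u n (s : S) : nrm (disp (u n) (val s)) <= a * r ^+ n.
  apply: le_trans (nrm_disp_le _ _) _.
  have -> : a * r ^+ n = (rho ^+ n * energy 0) `^ p^-1.
    rewrite powRM ?exprn_ge0 // [RHS]mulrC; congr (_ * _).
    by rewrite -!powR_mulrn // -!powRrM mulrC.
  by rewrite ge0_ler_powR ?nnegrE ?mulr_ge0 ?exprn_ge0 // ltW.
have u_step n : nrm (u n.+1 - u n) <= a * r ^+ n.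
  rewrite /u iterS -/(u n) /next addrC addKr nrmVn.
  have ar0 : 0 <= a * r ^+ n by rewrite mulr_ge0 ?exprn_ge0.
  have := nrm_mean_le ar0 (disp_u n).
  have := nrm_ge0 (mean (fun s : S => disp (u n) (val s))).
  lra.
have [x [c ux]] := X_complete r0 r1 u_step.
(* The constant [a] bounds the displacement at [u n]; passing from [u n] to [x] changes it by two
   vectors of norm at most c r^n. *)
exists x => s; apply: nrm_eq0; apply: (@le_geometric_le0 _ _ (a + 2 * c) r) => // n.
have -> : disp x (val s) =
    disp (u n) (val s) + ((u n - x) - pi (val s) (u n - x)).
  rewrite /disp linearB /= opprB !addrA subrK [RHS]addrC !addrA addNr add0r.
  by rewrite addrC addrA.
have := disp_u n s; have := ux n.
have := nrmD (disp (u n) (val s)) ((u n - x) - pi (val s) (u n - x)).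
have := nrmD (u n - x) (- pi (val s) (u n - x)); rewrite nrmN nrm_pi.
lra.
Qed.

(** The displacement at the fixed point is a cocycle vanishing on [S], hence on all products of
    generators. *)
Lemma cocycle_coboundary : coboundary pi b.
Proof.
have [x xS] := fixed_point; exists x => g.
suff /eqP : disp x g = 0 by rewrite subr_eq0 addrC eq_sym -subr_eq eq_sym => /eqP.
have [w wS ->] := S_generating g.
elim: w wS => [|s w IHw] wS; first by rewrite big_nil disp1.
rewrite big_cons dispM IHw => [|t tw]; last by rewrite wS // inE tw orbT.
have sS : s \in S by rewrite wS // mem_head.
by rewrite linear0 add0r (xS [` sS]%fset).
Qed.

End FixedPoint.

(** * Passage from a seminormed space to its normed quotient *)

Section SeminormedFixedPoint.
Local Open Scope quotient_scope.
Variables (R : realType) (K : numFieldType) (iota : {rmorphism R -> K}).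
Hypothesis iota_le : {mono iota : x y / x <= y}.
Variables (V : lmodType K) (N : seminorm V) (nrm : V -> R).
Hypothesis N_nrm : forall v, N v = iota (nrm v).
Hypothesis V_complete : forall (u : nat -> V) (a r : R), 0 <= r -> r < 1 ->
  (forall n, nrm (u n.+1 - u n) <= a * r ^+ n) ->
  exists v c, forall n, nrm (u n - v) <= c * r ^+ n.

Variables (G : groupType) (S : {fset G}) (D : nat) (p C : R).
Hypothesis S_generating : generating S.
Hypothesis S_sym : forall s, s \in S -> s^-1%g \in S.
Hypothesis S_regular : forall s : S, #|[pred t : S | link_graph s t]| = D.
Hypothesis p_ge1 : 1 <= p.
Hypothesis C_ge0 : 0 <= C.
Hypothesis CD_lt1 : C * D%:R < 1.
Hypothesis V_poincare : forall f : S -> V,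
  \sum_s nrm (f s - mean f) `^ p <=
  C * \sum_s \sum_(t | link_graph s t) nrm (f s - f t) `^ p.

Local Notation Q := (normed_quotient N).
Local Notation "[ x ]" := (\pi_Q x).

Let piD (x y : V) : [x + y] = [x] + [y].
Proof. exact: (@Quotient.pi_add V (seminorm_ker N) x y). Qed.

Let piN (x : V) : [- x] = - [x].
Proof. exact: (@Quotient.pi_opp V (seminorm_ker N) x). Qed.

Let pi0 : [0] = 0.
Proof. by apply: (addIr [0]); rewrite -piD !add0r. Qed.

Let piZ a (x : V) : [a *: x] = a *: [x].
Proof.
apply/eqP; rewrite [eqbRHS](_ : _ = [a *: repr [x]]) //.
by rewrite normed_quotient_eq -scalerBr rpredZ // -normed_quotient_eq reprK.
Qed.

Let pi_sum (I : finType) (P : pred I) (f : I -> V) :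
  [\sum_(i | P i) f i] = \sum_(i | P i) [f i].
Proof. by apply: (big_morph (fun x : V => [x])); [exact: piD|exact: pi0]. Qed.

Let qnrm (x : Q) : R := nrm (repr x).

Let qnrm_pi x : qnrm [x] = nrm x.
Proof.
have iota_inj : injective iota.
  by move=> a b ab; apply/eqP; rewrite eq_le -!iota_le ab lexx.
apply: iota_inj; rewrite -!N_nrm; apply: seminorm_sub_eq.
by rewrite -normed_quotient_eq reprK.
Qed.

(** The representation acts on classes, while completeness and the Poincare inequality concern
    functions. Both descend by choosing representatives, since the norm of a class is the seminorm
    of any of its members. *)
Theorem H1_normed_quotient (pi : isometric_rep G Q) : H1_eq0 pi.
Proof.
move=> b b_cocycle.
apply: (@cocycle_coboundary R K iota iota_le Q qnrm _ _ G S D p C) => //.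
- by move=> x; rewrite -{1}[x]reprK normed_quotient_normE N_nrm.
- move=> u a r r0 r1 u_step.
  have [|v [c vu]] := V_complete (u := repr \o u) r0 r1 (a := a).
    move=> n; apply: le_trans (u_step n).
    by rewrite -qnrm_pi piD piN !reprK.
  exists [v], c => n; apply: le_trans (vu n).
  by rewrite -qnrm_pi piD piN !reprK.
- move=> f; have := V_poincare (repr \o f).
  rewrite (_ : \sum_s nrm _ `^ p = \sum_s qnrm (f s - mean f) `^ p).
    under [X in _ <= C * X -> _]eq_bigr => s _ do under eq_bigr => t _ do
      rewrite /= -qnrm_pi piD piN !reprK.
    exact.
  apply: eq_bigr => s _; rewrite -qnrm_pi piD piN reprK /mean piZ pi_sum.
  by under eq_bigr do rewrite /= reprK.
Qed.

End SeminormedFixedPoint.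

(** * Norms of Lp *)

Section LnormIneq.
Local Open Scope classical_set_scope.
Context d (Y : measurableType d) (R : realType).
Variables (mu : {measure set Y -> \bar R}) (p : R) (p1 : (1 <= p%:E)%E).
Local Notation Np f := ('N[mu]_p%:E[EFin \o f])%E.

Let p0 : 0 < p. Proof. by rewrite (lt_le_trans ltr01) // -lee_fin. Qed.

Lemma measurable_normr_powR (f : Y -> R) : measurable_fun [set: Y] f ->
  measurable_fun [set: Y] (fun y => (`|f y| `^ p)%:E).
Proof.
move=> mf; apply/measurable_EFinP.
apply: (measurableT_comp (measurable_powR _)).
exact: measurableT_comp.
Qed.

Lemma Lnorm_poweR (f : Y -> R) :
  (Np f `^ p = \int[mu]_y (`|f y| `^ p)%:E)%E.
Proof. by rewrite poweR_Lnorm ?gt_eqF. Qed.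

Lemma le_Lnorm_powR (f : Y -> R) (a : R) : 0 <= a ->
  (Np f <= a%:E <-> \int[mu]_y (`|f y| `^ p)%:E <= (a `^ p)%:E)%E.
Proof.
move=> a0; rewrite -Lnorm_poweR -poweR_EFin; split => [fa|].
  by apply: gt0_ler_poweR fa; rewrite ?(ltW p0) // in_itv /= leey ?Lnorm_ge0 // lee_fin a0.
move=> /(gt0_ler_poweR (r := p^-1)).
rewrite -!poweRrM mulfV ?gt_eqF // !poweRe1 ?Lnorm_ge0 ?lee_fin //; apply.
- by rewrite invr_ge0 ltW.
- by rewrite in_itv /= leey poweR_ge0.
- by rewrite in_itv /= leey andbT lee_fin powR_ge0.
Qed.

Lemma Lnorm_sum (g : nat -> Y -> R) n :
  (forall k, measurable_fun [set: Y] (g k)) ->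
  (Np (fun y => \sum_(k < n) g k y)%R <= \sum_(k < n) Np (g k))%E.
Proof.
move=> mg; elim: n => [|n IHn].
  rewrite big_ord0 (_ : _ \o _ = cst 0%E) ?Lnorm0 ?gt_eqF //.
  by apply/funext => y /=; rewrite big_ord0.
rewrite big_ord_recr /= (_ : EFin \o _ =
    EFin \o ((fun y => \sum_(k < n) g k y) \+ g n)%R).
  apply: le_trans (eminkowski _ _ _ _) _ => //.
    exact: measurable_sum.
  by rewrite leeD2r.
by apply/funext => y /=; rewrite big_ord_recr.
Qed.

(* Monotone convergence for the p-th powers of the partial sums. *)
Lemma Lnorm_sum_dominated (g : nat -> Y -> R) (a : R) : 0 <= a ->
  (forall k, measurable_fun [set: Y] (g k)) -> (forall k y, 0 <= g k y) ->
  (forall n, (\sum_(k < n) Np (g k) <= a%:E)%E) ->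
  exists G : Y -> \bar R, [/\ measurable_fun [set: Y] G,
    (forall y, 0 <= G y)%E,
    (forall n y, (((\sum_(k < n) g k y) `^ p)%:E <= G y)%E) &
    (\int[mu]_y G y <= (a `^ p)%:E)%E].
Proof.
move=> a0 mg g0 ga.
pose H n y : \bar R := ((\sum_(k < n) g k y) `^ p)%:E.
have H_nd y : nondecreasing_seq (H ^~ y).
  apply/nondecreasing_seqP => n.
  rewrite lee_fin ge0_ler_powR ?nnegrE ?sumr_ge0 ?(ltW p0) //.
  by rewrite big_ord_recr lerDl.
have HE n y : H n y = (`|\sum_(k < n) g k y| `^ p)%:E.
  by rewrite ger0_norm ?sumr_ge0.
have mH n : measurable_fun [set: Y] (H n).
  rewrite (funext (HE n)); apply: measurable_normr_powR.
  exact: measurable_sum.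
have H0 n y : (0 <= H n y)%E by rewrite lee_fin powR_ge0.
have H_cvg y : cvgn (H ^~ y) by apply: ereal_nondecreasing_is_cvgn.
exists (fun y => limn (H ^~ y)); split.
- by apply: (emeasurable_fun_cvg H) => // y _; exact: H_cvg.
- by move=> y; apply: lime_ge => //; exact: nearW.
- move=> n y; apply: lime_ge => //.
  by exists n => // m /= nm; exact: H_nd.
- rewrite monotone_convergence //.
  apply: lime_le.
    apply: ereal_nondecreasing_is_cvgn => m n mn.
    by apply: ge0_le_integral => // y _; exact: H_nd.
  apply: nearW => n.
  under eq_integral do rewrite HE.
  by apply/le_Lnorm_powR => //; exact: le_trans (Lnorm_sum _ _) (ga n).
Qed.

End LnormIneq.

(** * Completeness of Lp, with a rate *)

Lemma geometric_sum_le (R : realType) (r : R) n : 0 <= r -> r < 1 ->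
  \sum_(k < n) r ^+ k <= (1 - r)^-1.
Proof.
move=> r0 r1; have r1' : 0 < 1 - r by rewrite subr_gt0.
rewrite -[leRHS]mul1r ler_pdivlMr // mulrC.
by rewrite -opprB mulNr -subrX1 opprB gerBl exprn_ge0.
Qed.

Section LfunComplete.
Local Open Scope classical_set_scope.
Context d (Y : measurableType d) (R : realType).
Variables (mu : {measure set Y -> \bar R}) (p : R) (p1 : (1 <= p%:E)%E).
Local Notation Np f := ('N[mu]_p%:E[EFin \o f])%E.

Let p0 : 0 < p. Proof. by rewrite (lt_le_trans ltr01) // -lee_fin. Qed.

Let powR_le_root (x c : R) : 0 <= x -> x `^ p <= c -> x <= c `^ p^-1.
Proof.
move=> x0 xc; rewrite -[leLHS](@powR_rootK _ p) ?gt_eqF //.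
rewrite ge0_ler_powR ?nnegrE ?powR_ge0 ?invr_ge0 ?(ltW p0) //.
exact: le_trans (powR_ge0 _ _) xc.
Qed.

(** The Riesz-Fischer argument: almost everywhere the increments are absolutely summable, so [u]
    converges pointwise, and a function dominating the n-th tail controls the distance from [u n] to
    the limit. *)
Lemma Lfun_complete (u : nat -> Y -> R) (a r : R) :
  0 <= r -> r < 1 -> (forall n, u n \in Lfun mu p%:E) ->
  (forall n, Np (u n.+1 \- u n)%R <= (a * r ^+ n)%:E)%E ->
  exists2 f, f \in Lfun mu p%:E &
    forall n, (Np (u n \- f)%R <= (a / (1 - r) * r ^+ n)%:E)%E.
Proof.
move=> r0 r1 uL u_step.
have mu_ n : measurable_fun [set: Y] (u n).
  by have /andP[/set_mem] := uL n.
have a0 : 0 <= a.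
  by have := le_trans (Lnorm_ge0 _ _ _) (u_step 0%N); rewrite expr0 mulr1 lee_fin.
have ar0 : 0 <= a / (1 - r) by rewrite divr_ge0 // subr_ge0 ltW.
pose g k y := `|u k.+1 y - u k y|.
have mg k : measurable_fun [set: Y] (g k).
  by apply: measurableT_comp => //; exact: measurable_funB.
have Ng k : Np (g k) = Np (u k.+1 \- u k)%R.
  by rewrite -[RHS]Lnorm_abse.
(* Each tail gets its own dominating function, whose integral carries the factor r^n; 1/(1 - r)
   bounds the geometric sum. *)
have tail n : exists G : Y -> \bar R, [/\ measurable_fun [set: Y] G,
    (forall y, 0 <= G y)%E,
    (forall m y, (((\sum_(k < m) g (n + k)%N y) `^ p)%:E <= G y)%E) &
    (\int[mu]_y G y <= ((a / (1 - r) * r ^+ n) `^ p)%:E)%E].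
  apply: (@Lnorm_sum_dominated _ _ _ mu p p1 (fun k => g (n + k)%N)) => //.
    by rewrite mulr_ge0 ?exprn_ge0.
  by move=> k y; exact: normr_ge0.
  move=> m; apply: (@le_trans _ _ (\sum_(k < m) (a * r ^+ (n + k))%:E)%E).
    by apply: lee_sum => k _; rewrite Ng.
  rewrite sumEFin lee_fin -mulr_sumr.
  under eq_bigr do rewrite exprD.
  rewrite -mulr_sumr mulrA mulrAC ler_wpM2r ?exprn_ge0 // ler_wpM2l //.
  exact: geometric_sum_le.
pose G n := projT1 (cid (tail n)).
have mG n : measurable_fun [set: Y] (G n) by rewrite /G; case: cid => ? [].
have G0 n y : (0 <= G n y)%E by rewrite /G; case: cid => ? [].
have gG n m y : (((\sum_(k < m) g (n + k)%N y) `^ p)%:E <= G n y)%E.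
  by rewrite /G; case: cid => ? [].
have iG n : (\int[mu]_y G n y <= ((a / (1 - r) * r ^+ n) `^ p)%:E)%E.
  by rewrite /G; case: cid => ? [].
clearbody G => {tail}.
pose A := [set: Y] `&` [set y | G 0%N y \is a fin_num].
have mA : measurable A by exact: emeasurable_fin_num.
have aeA : {ae mu, forall y, A y}.
  have iG0 : mu.-integrable [set: Y] (G 0%N).
    apply/integrableP; split => //.
    under eq_integral do rewrite gee0_abs //.
    by rewrite (le_lt_trans (iG 0%N)) ?ltry.
  have := integrable_ae measurableT iG0.
  by apply: filterS => y /(_ I).
have sum_le n m y : G n y \is a fin_num ->
    \sum_(k < m) g (n + k)%N y <= fine (G n y) `^ p^-1.
  move=> Gfin; apply: powR_le_root; first by apply: sumr_ge0 => k _; exact: normr_ge0.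
  by rewrite -lee_fin fineK.
have dist_le n k y : `|u n y - u (n + k)%N y| <= \sum_(j < k) g (n + j)%N y.
  elim: k => [|k IHk]; first by rewrite big_ord0 addn0 subrr normr0.
  rewrite big_ord_recr /= addnS.
  apply: le_trans (ler_distD (u (n + k)%N y) _ _) _.
  by rewrite lerD // distrC.
have u_cvg y : A y -> cvgn (u ^~ y).
  move=> [_ Gfin].
  have : cvgn [normed series (telescope (u ^~ y))].
    rewrite (_ : [normed series _] = fun n => \sum_(k < n) g k y); last first.
      apply/funext => n.
      by rewrite -[LHS]/(\sum_(0 <= k < n) g k y) big_mkord.
    apply: nondecreasing_is_cvgn.
      apply/nondecreasing_seqP => n; rewrite big_ord_recr lerDl.
      exact: normr_ge0.
    by exists (fine (G 0%N y) `^ p^-1) => _ [n _ <-]; exact: (sum_le 0%N n y Gfin).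
  move=> /normed_cvg; rewrite telescopeK => /cvg_ex[l ul].
  apply/cvg_ex; exists (l + u 0%N y).
  rewrite (_ : u ^~ y = (fun n => u n y - u 0%N y) \+ cst (u 0%N y)).
    by apply: cvgD => //; exact: cvg_cst.
  by apply/funext => n /=; rewrite subrK.
(* Cutting off by the indicator of [A] forces convergence everywhere, which makes the limit
   measurable. *)
pose v n y := \1_A y * u n y.
have vA n y : A y -> v n y = u n y.
  by move=> yA; rewrite /v indicE mem_set // mul1r.
have v_cvg y : cvgn (v ^~ y).
  have [yA|yA] := pselect (A y).
    rewrite (_ : v ^~ y = u ^~ y); first exact: u_cvg.
    by apply/funext => n; exact: vA.
  rewrite (_ : v ^~ y = cst 0); first exact: is_cvg_cst.
  by apply/funext => n; rewrite /v indicE memNset // mul0r.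
pose f y := limn (v ^~ y).
have mf : measurable_fun [set: Y] f.
  apply: (@measurable_fun_cvg _ _ _ _ v) => [n|y _]; last exact: v_cvg.
  by apply: measurable_funM => //; exact: measurable_indic.
have uf_le n y : A y -> ((`|u n y - f y| `^ p)%:E <= G n y)%E.
  move=> yA; have [/eqP ->|] := boolP (G n y == +oo%E); first exact: leey.
  rewrite -ltey => Gfin; have {}Gfin : G n y \is a fin_num.
    by rewrite ge0_fin_numE.
  have : `|u n y - f y| <= fine (G n y) `^ p^-1.
    have ufc : `|u n y - v m y| @[m --> \oo] --> `|u n y - f y|.
      by apply: cvg_norm; apply: cvgB; [exact: cvg_cst|exact: v_cvg].
    rewrite -(cvg_lim _ ufc) //; apply: limr_le.
      by apply/cvg_ex; exists `|u n y - f y|.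
    exists n => // m /= nm; rewrite vA // -(subnKC nm).
    exact: le_trans (dist_le _ _ _) (sum_le n (m - n)%N y Gfin).
  move=> uf; rewrite -[leRHS]fineK // lee_fin.
  apply: (@le_trans _ _ ((fine (G n y) `^ p^-1) `^ p)).
    by rewrite ge0_ler_powR ?nnegrE ?normr_ge0 ?powR_ge0 ?(ltW p0).
  by rewrite -powRrM mulVf ?gt_eqF // powRr1 // fine_ge0.
have Nuf n : (Np (u n \- f)%R <= (a / (1 - r) * r ^+ n)%:E)%E.
  apply/le_Lnorm_powR => //; first by rewrite mulr_ge0 ?exprn_ge0.
  apply: le_trans (iG n); apply: ae_ge0_le_integral => //.
    by apply: measurable_normr_powR; exact: measurable_funB.
  by apply: filterS aeA => y yA _; exact: uf_le.
exists f => //.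
apply/andP; split; apply: mem_set => //.
have /andP[_ /set_mem u0_fin] := uL 0%N.
(* The norm of [f] is finite by Minkowski, both [u 0] and [u 0 - f] having finite norm. *)
rewrite /= /finite_norm (_ : f = u 0%N \+ (-%R \o (u 0%N \- f)))%R; last first.
  by apply/funext => y /=; rewrite opprB addrC subrK.
apply: le_lt_trans (eminkowski _ _ _ _) _ => //.
  by apply: measurableT_comp => //; exact: measurable_funB.
rewrite lte_add_pinfty //.
rewrite (_ : Np _ = Np (u 0%N \- f)%R).
  exact: le_lt_trans (Nuf 0%N) (ltry _).
by rewrite -[RHS]oppe_Lnorm.
Qed.

End LfunComplete.

Section LfunFacts.
Local Open Scope classical_set_scope.
Context d (Y : measurableType d) (R : realType).
Variables (mu : {measure set Y -> \bar R}) (p : R) (p1 : (1 <= p%:E)%E).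
Local Notation Np f := ('N[mu]_p%:E[EFin \o f])%E.

Let p0 : 0 < p. Proof. by rewrite (lt_le_trans ltr01) // -lee_fin. Qed.

Lemma Lfun_measurable (f : Y -> R) :
  f \in Lfun mu p%:E -> measurable_fun [set: Y] f.
Proof. by move=> /andP[/set_mem]. Qed.

Lemma Lfun_fineK (f : Y -> R) : f \in Lfun mu p%:E -> (fine (Np f))%:E = Np f.
Proof.
move=> /andP[_ /set_mem ffin]; rewrite fineK // ge0_fin_numE //.
exact: Lnorm_ge0.
Qed.

Lemma Lnorm_le_norm (u v : Y -> R) :
  measurable_fun [set: Y] u -> measurable_fun [set: Y] v ->
  (forall y, `|u y| <= `|v y|) -> (Np u <= Np v)%E.
Proof.
move=> mu_ mv uv; rewrite unlock /Lnorm; apply: gt0_ler_poweR.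
- by rewrite invr_ge0 ltW.
- by rewrite in_itv /= leey andbT integral_ge0 // => y _; exact: poweR_ge0.
- by rewrite in_itv /= leey andbT integral_ge0 // => y _; exact: poweR_ge0.
apply: ge0_le_integral => //=; try exact: measurable_normr_powR.
by move=> y _; rewrite lee_fin ge0_ler_powR ?nnegrE ?normr_ge0 ?(ltW p0).
Qed.

(** The p-th power of an Lp norm is the integral of the p-th power, so the pointwise inequality
    integrates to one between norms. *)
Lemma Lnorm_poincare (T : finType) (e : rel T) (C : R)
    (u : T -> Y -> R) (v : T -> T -> Y -> R) : 0 <= C ->
  (forall s, u s \in Lfun mu p%:E) -> (forall s t, v s t \in Lfun mu p%:E) ->
  (forall y, \sum_s `|u s y| `^ p <=
             C * \sum_s \sum_(t | e s t) `|v s t y| `^ p) ->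
  \sum_s fine (Np (u s)) `^ p <=
  C * \sum_s \sum_(t | e s t) fine (Np (v s t)) `^ p.
Proof.
move=> C0 uL v2L uv2.
pose P (st : T * T) := e st.1 st.2; pose v1 (st : T * T) := v st.1 st.2.
have vL j : v1 j \in Lfun mu p%:E by exact: v2L.
have uv y : \sum_s `|u s y| `^ p <= C * \sum_(j | P j) `|v1 j y| `^ p.
  apply: le_trans (uv2 y) _.
  by rewrite (pair_big_dep predT e (fun s t => `|v s t y| `^ p)).
rewrite (pair_big_dep predT e (fun s t => fine (Np (v s t)) `^ p)) /=.
rewrite -/(\sum_(j | P j) fine (Np (v1 j)) `^ p).
have intE (w : Y -> R) : w \in Lfun mu p%:E ->
    ((fine (Np w) `^ p)%:E = \int[mu]_y (`|w y| `^ p)%:E)%E.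
  by move=> wL; rewrite -Lnorm_poweR // -Lfun_fineK.
have mw (w : Y -> R) : w \in Lfun mu p%:E ->
    measurable_fun [set: Y] (fun y => (`|w y| `^ p)%:E).
  by move=> /Lfun_measurable; exact: measurable_normr_powR.
have sumE (K : finType) (Q : pred K) (w : K -> Y -> R) :
    (forall k, w k \in Lfun mu p%:E) ->
    ((\sum_(k | Q k) fine (Np (w k)) `^ p)%:E =
     \int[mu]_y (\sum_(k | Q k) `|w k y| `^ p)%:E)%E.
  move=> wL; rewrite -sumEFin; under eq_bigr do rewrite intE //.
  rewrite -[LHS]big_filter -ge0_integral_sum //.
  - by apply: eq_integral => y _; rewrite -sumEFin -[RHS]big_filter.
  - by move=> k; exact: mw.
have msum (K : finType) (Q : pred K) (w : K -> Y -> R) :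
    (forall k, w k \in Lfun mu p%:E) ->
    measurable_fun [set: Y] (fun y => \sum_(k | Q k) `|w k y| `^ p).
  move=> wL; under eq_fun do rewrite -big_filter.
  by apply: measurable_sum => k; apply/measurable_EFinP; exact: mw.
rewrite -lee_fin EFinM !sumE // -ge0_integralZl_EFin //.
- apply: ge0_le_integral => //.
  + by move=> y _; rewrite lee_fin sumr_ge0.
  + by apply/measurable_EFinP; exact: msum.
  + under eq_fun do rewrite -EFinM.
    by apply/measurable_EFinP; apply: measurable_funM => //; exact: msum.
  + by move=> y _; rewrite -EFinM lee_fin.
- by move=> y _; rewrite lee_fin sumr_ge0.
- by apply/measurable_EFinP; exact: msum.
Qed.

End LfunFacts.

(** * Poincare inequalities for scalar and Lp-valued functions *)

Section ScalarPoincare.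
Variables (R : realType) (F : finFieldType) (T : finType) (e : rel T).
Hypothesis e_incidence : graph_isomorphic e (@incidence_graph F).
Variables (p : R).
Hypothesis p_ge2 : 2 <= p.

(** Here [x1] and [x2] are real and imaginary parts. Squared moduli add, so the l^2 inequality keeps
    its constant for complex functions, and [lp_le_of_l2_le] is applied to the moduli. *)
Lemma incidence_graph_poincare_lp (x1 x2 : T -> R) :
  \sum_s Num.sqrt ((x1 s - #|T|%:R^-1 * \sum_t x1 t) ^+ 2 +
                   (x2 s - #|T|%:R^-1 * \sum_t x2 t) ^+ 2) `^ p <=
  poincare_const #|F| p * \sum_s \sum_(t | e s t)
    Num.sqrt ((x1 s - x1 t) ^+ 2 + (x2 s - x2 t) ^+ 2) `^ p.
Proof.
have q_gt0 : (0 < #|F|)%N by apply/card_gt0P; exists 0.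
rewrite /poincare_const -(card_incidence_graph e_incidence).
have -> : \sum_s \sum_(t | e s t)
      Num.sqrt ((x1 s - x1 t) ^+ 2 + (x2 s - x2 t) ^+ 2) `^ p =
    \sum_(st | e st.1 st.2)
      Num.sqrt ((x1 st.1 - x1 st.2) ^+ 2 + (x2 st.1 - x2 st.2) ^+ 2) `^ p.
  by rewrite pair_big_dep.
apply: lp_le_of_l2_le => //.
  by rewrite invr_ge0 mulr_ge0 // subr_ge0 ltW // sqrt_lt_succ.
under eq_bigr do rewrite sqr_sqrtr ?addr_ge0 ?sqr_ge0 //.
under [X in _ <= _ * X]eq_bigr do rewrite sqr_sqrtr ?addr_ge0 ?sqr_ge0 //.
rewrite !big_split mulrDr /= lerD //.
  by rewrite -(pair_big_dep predT e (fun s t => (x1 s - x1 t) ^+ 2)) /=;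
    exact: incidence_graph_poincare_l2.
by rewrite -(pair_big_dep predT e (fun s t => (x2 s - x2 t) ^+ 2)) /=;
    exact: incidence_graph_poincare_l2.
Qed.

End ScalarPoincare.

Section RealLpPoincare.
Local Open Scope classical_set_scope.
Context d (Y : measurableType d) (R : realType).
Variables (mu : {measure set Y -> \bar R}) (p : R) (p1 : (1 <= p%:E)%E).
Local Notation Np f := ('N[mu]_p%:E[EFin \o f])%E.
Local Notation N := (Lp_seminorm mu p1).

Lemma Lp_seminorm_complete (u : nat -> LfunType mu p1) (a r : R) :
  0 <= r -> r < 1 -> (forall n, N (u n.+1 - u n) <= a * r ^+ n) ->
  exists v c, forall n, N (u n - v) <= c * r ^+ n.
Proof.
move=> r0 r1 u_step.
have [|f fL uf] := Lfun_complete p1 r0 r1 (fun n => LfunP (u n)) (a := a).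
  by move=> n; have := u_step n; rewrite -lee_fin finite_norm_fine.
exists (Lfun_Sub p1 fL), (a / (1 - r)) => n.
by rewrite -lee_fin finite_norm_fine; exact: uf.
Qed.

Variables (F : finFieldType) (T : finType) (e : rel T).
Hypothesis e_incidence : graph_isomorphic e (@incidence_graph F).
Hypothesis p_ge2 : 2 <= p.

Lemma mean_LfunE (f : T -> LfunType mu p1) y :
  mean f y = #|T|%:R^-1 * \sum_s f s y.
Proof.
have sumE : (\sum_s f s) y = \sum_s f s y.
  by apply: (big_morph (fun g : LfunType mu p1 => g y)).
by rewrite -sumE.
Qed.

(** A real function is treated as a complex one with zero imaginary part; [0 - 0] keeps the shape of
    [incidence_graph_poincare_lp]. *)
Let norm_sub_LfunE (f g : LfunType mu p1) y :
  `|(f - g) y| = Num.sqrt ((f y - g y) ^+ 2 + (0 - 0) ^+ 2).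
Proof. by rewrite subr0 expr0n addr0 sqrtr_sqr. Qed.

Let norm_sub_mean_LfunE (f : T -> LfunType mu p1) s y : `|(f s - mean f) y| =
  Num.sqrt ((f s y - #|T|%:R^-1 * \sum_t f t y) ^+ 2 +
            (0 - #|T|%:R^-1 * \sum_(t : T) 0) ^+ 2).
Proof. by rewrite [X in 0 - _ * X]big1 // mulr0 norm_sub_LfunE mean_LfunE. Qed.

Lemma Lp_seminorm_poincare (f : T -> LfunType mu p1) :
  \sum_s N (f s - mean f) `^ p <=
  poincare_const #|F| p * \sum_s \sum_(t | e s t) N (f s - f t) `^ p.
Proof.
have NE (g : LfunType mu p1) : N g = fine (Np g) by [].
under eq_bigr do rewrite NE.
under [X in _ <= _ * X]eq_bigr do under eq_bigr do rewrite NE.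
apply: (Lnorm_poincare p1 (u := fun s => (f s - mean f : LfunType mu p1))
  (v := fun s t => (f s - f t : LfunType mu p1))).
- by rewrite mulr_ge0 ?powR_ge0.
- by move=> s; exact: LfunP.
- by move=> s t; exact: LfunP.
move=> y.
under eq_bigr do rewrite norm_sub_mean_LfunE.
under [X in _ <= _ * X]eq_bigr do under eq_bigr do rewrite norm_sub_LfunE.
exact: (incidence_graph_poincare_lp e_incidence p_ge2 (fun s => f s y) (fun=> 0)).
Qed.

End RealLpPoincare.

Section ComplexLpPoincare.
Local Open Scope classical_set_scope.
Context d (Y : measurableType d) (R : realType).
Variables (mu : {measure set Y -> \bar R}) (p : R) (p1 : (1 <= p%:E)%E).
Local Notation Np f := ('N[mu]_p%:E[EFin \o f])%E.
Local Notation L := (LfunType_complex mu p1).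

Let Ref (f : L) y : R := complex.Re (f y).
Let Imf (f : L) y : R := complex.Im (f y).
Let absf (f : L) y : R := Normc.normc (f y).

(** The complex seminorm with values in [R] instead of [R[i]], so that real powers of it can be
    taken. *)
Definition Lp_complex_norm (f : L) : R := fine (Np (absf f)).
Local Notation nu := Lp_complex_norm.

Let absfE f y : absf f y = Num.sqrt (Ref f y ^+ 2 + Imf f y ^+ 2).
Proof. by rewrite /absf /Ref /Imf; case: (f y). Qed.

Let measurable_Ref f : measurable_fun [set: Y] (Ref f).
Proof. by case: f => f /= fL; have /asboolP[] := fL. Qed.

Let measurable_Imf f : measurable_fun [set: Y] (Imf f).
Proof. by case: f => f /= fL; have /asboolP[] := fL. Qed.

Let measurable_abs (a b : Y -> R) : measurable_fun [set: Y] a ->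
  measurable_fun [set: Y] b ->
  measurable_fun [set: Y] (fun y => Num.sqrt (a y ^+ 2 + b y ^+ 2)).
Proof.
move=> ma mb.
rewrite (_ : (fun y => _) = fun y => (a y ^+ 2 + b y ^+ 2) `^ 2^-1).
  by apply: (measurableT_comp (measurable_powR _)); apply: measurable_funD;
    exact: measurable_funX.
by apply/funext => y; rewrite powR12_sqrt ?addr_ge0 ?sqr_ge0.
Qed.

Let measurable_absf f : measurable_fun [set: Y] (absf f).
Proof. by rewrite (funext (absfE f)); exact: measurable_abs. Qed.

Let absf_Lfun f : absf f \in Lfun mu p%:E.
Proof.
apply/andP; split; apply: mem_set; first exact: measurable_absf.
by case: f => f /= fL; have /asboolP[] := fL.
Qed.

Let Ref_le f y : `|Ref f y| <= `|absf f y|.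
Proof.
by rewrite absfE (ger0_norm (sqrtr_ge0 _)) -sqrtr_sqr ler_wsqrtr // lerDl sqr_ge0.
Qed.

Let Imf_le f y : `|Imf f y| <= `|absf f y|.
Proof.
by rewrite absfE (ger0_norm (sqrtr_ge0 _)) -sqrtr_sqr ler_wsqrtr // lerDr sqr_ge0.
Qed.

Let Lfun_le (g : Y -> R) (f : L) : measurable_fun [set: Y] g ->
  (forall y, `|g y| <= `|absf f y|) -> g \in Lfun mu p%:E.
Proof.
move=> mg gf; apply/andP; split; apply: mem_set => //.
have /andP[_ /set_mem] := absf_Lfun f.
by apply: le_lt_trans; exact: Lnorm_le_norm.
Qed.

Let RefB f g y : Ref (f - g) y = Ref f y - Ref g y.
Proof. by rewrite /Ref -raddfB. Qed.

Let ImfB f g y : Imf (f - g) y = Imf f y - Imf g y.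
Proof. by rewrite /Imf -raddfB. Qed.

Let nuE f : (nu f)%:E = Np (absf f).
Proof. exact: Lfun_fineK. Qed.

(** Real and imaginary parts are dominated by the modulus, so each converges by [Lfun_complete]. The
    norm of the error is at most the sum of the two errors, whence the factor 2 in the witness. *)
Lemma Lp_complex_complete (u : nat -> L) (a r : R) :
  0 <= r -> r < 1 -> (forall n, nu (u n.+1 - u n) <= a * r ^+ n) ->
  exists v c, forall n, nu (u n - v) <= c * r ^+ n.
Proof.
move=> r0 r1 u_step.
have stepE (h : L -> Y -> R) : (forall f g y, h (f - g) y = h f y - h g y) ->
    (forall f, measurable_fun [set: Y] (h f)) ->
    (forall f y, `|h f y| <= `|absf f y|) ->
    exists2 v, v \in Lfun mu p%:E &
      forall n, (Np (h (u n) \- v)%R <= (a / (1 - r) * r ^+ n)%:E)%E.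
  move=> hB mh h_le; apply: (Lfun_complete p1 r0 r1) => n.
    exact: Lfun_le.
  apply: (@le_trans _ _ (nu (u n.+1 - u n))%:E); last by rewrite lee_fin.
  rewrite nuE; apply: Lnorm_le_norm => //.
    by apply: measurable_funB.
  by move=> y /=; rewrite -hB.
have [v vL uv] := stepE Ref RefB measurable_Ref Ref_le.
have [w wL uw] := stepE Imf ImfB measurable_Imf Imf_le.
have mv := Lfun_measurable vL; have mw := Lfun_measurable wL.
have abs_le (s t : Y -> R) : measurable_fun [set: Y] s ->
    measurable_fun [set: Y] t ->
    (Np (fun y => Num.sqrt (s y ^+ 2 + t y ^+ 2))%R <= Np s + Np t)%E.
  move=> ms mt; have NpE (x : Y -> R) : Np (fun y => `|x y|)%R = Np x.
    by rewrite -[RHS]Lnorm_abse.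
  rewrite -[Np s]NpE -[Np t]NpE.
  have mn (x : Y -> R) : measurable_fun [set: Y] x ->
    measurable_fun [set: Y] (fun y => `|x y|) by move=> mx; exact: measurableT_comp.
  apply: le_trans (eminkowski _ (mn _ ms) (mn _ mt) p1).
  apply: Lnorm_le_norm => //; first exact: measurable_abs.
    by apply: measurable_funD; exact: mn.
  move=> y; rewrite (ger0_norm (sqrtr_ge0 _)) -sqrtr_sqr ler_wsqrtr //=.
  rewrite -(real_normK (num_real (s y))) -(real_normK (num_real (t y))).
  by have := normr_ge0 (s y); have := normr_ge0 (t y); nra.
pose z y := (v y +i* w y)%C.
have zL : z \in Lfun_complex mu p1.
  apply/asboolP; split => //.
  apply: le_lt_trans (abs_le v w mv mw) _.
  by have /andP[_ /set_mem vfin] := vL; have /andP[_ /set_mem wfin] := wL;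
    rewrite lte_add_pinfty.
exists (LfunComplex zL), (2 * (a / (1 - r))) => n.
rewrite -lee_fin nuE (_ : absf _ = fun y =>
    Num.sqrt ((Ref (u n) y - v y) ^+ 2 + (Imf (u n) y - w y) ^+ 2)); last first.
  by apply/funext => y; rewrite absfE RefB ImfB.
apply: le_trans (abs_le _ _ _ _) _; try exact: measurable_funB.
apply: le_trans (leeD (uv n) (uw n)) _.
by rewrite -EFinD lee_fin -mulrDl -mulr2n mulr_natl.
Qed.

Variables (F : finFieldType) (T : finType) (e : rel T).
Hypothesis e_incidence : graph_isomorphic e (@incidence_graph F).
Hypothesis p_ge2 : 2 <= p.

Let mean_Lfun_complexE (f : T -> L) y :
  mean f y = #|T|%:R^-1 * \sum_s f s y.
Proof.
have sumE : (\sum_s f s) y = \sum_s f s y.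
  by apply: (big_morph (fun g : L => g y)).
by rewrite -sumE.
Qed.

Let natVr_complex n : n%:R^-1 = (n%:R^-1)%:C%C :> R[i].
Proof. by rewrite fmorphV rmorph_nat. Qed.

Let Ref_mean (f : T -> L) y : Ref (mean f) y = #|T|%:R^-1 * \sum_t Ref (f t) y.
Proof.
rewrite /Ref mean_Lfun_complexE natVr_complex.
rewrite -(big_morph (@complex.Re R) (id1 := 0) (op1 := +%R) (id2 := 0) (op2 := +%R)) //.
  by case: (\sum_t _) => a b /=; rewrite mul0r subr0.
by case=> ? ? [].
Qed.

Let Imf_mean (f : T -> L) y : Imf (mean f) y = #|T|%:R^-1 * \sum_t Imf (f t) y.
Proof.
rewrite /Imf mean_Lfun_complexE natVr_complex.
rewrite -(big_morph (@complex.Im R) (id1 := 0) (op1 := +%R) (id2 := 0) (op2 := +%R)) //.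
  by case: (\sum_t _) => a b /=; rewrite mul0r addr0.
by case=> ? ? [].
Qed.

Let abs_sub (f g : L) y : `|absf (f - g) y| =
  Num.sqrt ((Ref f y - Ref g y) ^+ 2 + (Imf f y - Imf g y) ^+ 2).
Proof. by rewrite absfE RefB ImfB ger0_norm ?sqrtr_ge0. Qed.

Let abs_sub_mean (f : T -> L) s y : `|absf (f s - mean f) y| =
  Num.sqrt ((Ref (f s) y - #|T|%:R^-1 * \sum_t Ref (f t) y) ^+ 2 +
            (Imf (f s) y - #|T|%:R^-1 * \sum_t Imf (f t) y) ^+ 2).
Proof. by rewrite abs_sub Ref_mean Imf_mean. Qed.

Lemma Lp_complex_poincare (f : T -> L) :
  \sum_s nu (f s - mean f) `^ p <=
  poincare_const #|F| p * \sum_s \sum_(t | e s t) nu (f s - f t) `^ p.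
Proof.
apply: (Lnorm_poincare p1 (u := fun s => absf (f s - mean f))
  (v := fun s t => absf (f s - f t))).
- by rewrite mulr_ge0 ?powR_ge0.
- by move=> s; exact: absf_Lfun.
- by move=> s t; exact: absf_Lfun.
move=> y.
under eq_bigr do rewrite abs_sub_mean.
under [X in _ <= _ * X]eq_bigr do under eq_bigr do rewrite abs_sub.
exact: (incidence_graph_poincare_lp e_incidence p_ge2
  (fun s => Ref (f s) y) (fun s => Imf (f s) y)).
Qed.

End ComplexLpPoincare.

Unset Implicit Arguments.

Theorem theorem5p1 (R : realType) (q k n : nat)
  (k_prime : prime k) (n_gt0 : (0 < n)%N) (q_def : q = (k ^ n)%N)
  (G : groupType) (G_A2 : A2tilde_group q G)
  (p : R) (p_ge2 : 2 <= p)
  (p_lt : p <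
    (ln (q%:R ^+ 2 + q%:R + 1) + ln (q%:R + 1)) /
    (2^-1 * ln (2 * (q%:R ^+ 2 + q%:R + 1) * (q%:R + 1)) - ln 2
       - ln (Num.sqrt (1 - Num.sqrt q%:R / (q%:R + 1)))))
  (d : measure_display) (Y : measurableType d) (mu : {measure set Y -> \bar R})
  (p1 : (1 <= p%:E)%E) :
  (forall pi : isometric_rep G (Lp mu p1), H1_eq0 pi) /\
  (forall pi : isometric_rep G (Lp_complex mu p1), H1_eq0 pi).
Proof.
have [F [S [F_card S_gen S_sym _ S_incidence]]] := G_A2.
have q_gt0 : (0 < q)%N by rewrite q_def expn_gt0 prime_gt0.
have p_ge1 : 1 <= p by rewrite -lee_fin.
have C_ge0 : 0 <= poincare_const q p by rewrite mulr_ge0 ?powR_ge0.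
have CD_lt1 := poincare_const_lt1 q_gt0 p_ge2 p_lt.
have S_regular (s : S) : #|[pred t : S | link_graph s t]| = q.+1.
  by rewrite -F_card; exact: incidence_graph_regular.
split=> pi.
  apply: (@H1_normed_quotient R R idfun _ _ _ (Lp_seminorm mu p1) _ _ G S
    q.+1 p (poincare_const q p)) => //.
    exact: Lp_seminorm_complete.
  by move=> f; rewrite -F_card; exact: Lp_seminorm_poincare.
apply: (@H1_normed_quotient R _ (real_complex R) _ _ (Lp_complex_seminorm mu p1)
  (@Lp_complex_norm _ _ _ mu p p1) _ _ G S q.+1 p (poincare_const q p)) => //.
- by move=> x y; exact: lecR.
- exact: Lp_complex_complete.
- by move=> f; rewrite -F_card; exact: Lp_complex_poincare.
Qed.
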